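(* Consider Morse polynomials of degree 4 whose degree-4 homogeneous part is positive on $\mathbb R^2\setminus\{0\}$ and non-degenerate. For such a polynomial let $M$ be the number of its critical points in $\mathbb R^2$ and $m_+$ the number of its local maxima. Then the set of pairs $(M,m_+)$ realized by such polynomials is exactly $$\{(1,0),(3,0),(5,0),(7,0),(9,0),(3,1),(5,1),(7,1),(9,1)\};$$ in particular such a polynomial has at most one local maximum.
   Context: A homogeneous polynomial of degree 4 in $(x,y)$ with real coefficients is called non-degenerate if it is a product of four pairwise non-proportional linear forms over $\mathbb C$. A Morse polynomial of degree 4 is a real polynomial $\mathbb R^2\to\mathbb R$ of degree 4 with non-degenerate degree-4 homogeneous part, all of whose critical points in $\mathbb C^2$ are non-degenerate (there are then exactly 9 of them in $\mathbb C^2$). *)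

(* Defs.v *)
From HB Require Import structures.
From mathcomp Require Import all_boot all_order all_algebra.
From mathcomp Require Import reals.
From mathcomp Require Import complex.
Set Implicit Arguments. Unset Strict Implicit. Unset Printing Implicit Defensive.
Import Order.TTheory GRing.Theory Num.Theory.
Local Open Scope ring_scope.

(* A real polynomial of degree <= 4 in (x,y) is given by its coefficients:
   f(x,y) = \sum_{i+j<=4} c i j x^i y^j  (entries with i+j>4 are ignored). *)
Definition coeffs4 (R : Type) := 'I_5 -> 'I_5 -> R.

(* Evaluation of the formal partial derivative d^a/dx^a d^b/dy^b of the
   polynomial with coefficients c (in a commutative ring K) at (z,w).
   Uses the falling factorial i ^_ a (= 0 when a > i). *)
Definition pderiv_eval (K : comRingType) (c : coeffs4 K) (a b : nat) (z w : K) : K :=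
  \sum_(i < 5) \sum_(j < 5)
    (if (i + j <= 4)%N
     then c i j * ((i ^_ a)%:R * (j ^_ b)%:R) * (z ^+ (i - a) * w ^+ (j - b))
     else 0).

Definition peval (K : comRingType) (c : coeffs4 K) (z w : K) : K :=
  pderiv_eval c 0 0 z w.

Definition top4_eval (K : comRingType) (c : coeffs4 K) (z w : K) : K :=
  \sum_(i < 5) \sum_(j < 5)
    (if (i + j == 4)%N then c i j * (z ^+ i * w ^+ j) else 0).

Definition cplx (R : rcfType) (c : coeffs4 R) : coeffs4 R[i] :=
  fun i j => Complex (c i j) 0.

Definition is_crit (K : comRingType) (c : coeffs4 K) (z w : K) : Prop :=
  pderiv_eval c 1 0 z w = 0 /\ pderiv_eval c 0 1 z w = 0.

Definition hess_det (K : comRingType) (c : coeffs4 K) (z w : K) : K :=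
  pderiv_eval c 2 0 z w * pderiv_eval c 0 2 z w
  - pderiv_eval c 1 1 z w * pderiv_eval c 1 1 z w.

Definition nondeg_top (R : rcfType) (c : coeffs4 R) : Prop :=
  exists (p q : 'I_4 -> R[i]),
    (forall z w : R[i], top4_eval (cplx c) z w = \prod_(k < 4) (p k * z + q k * w))
    /\ (forall k l : 'I_4, k != l -> p k * q l - q k * p l != 0).

Definition morse4 (R : rcfType) (c : coeffs4 R) : Prop :=
  nondeg_top c /\
  (forall z w : R[i], is_crit (cplx c) z w -> hess_det (cplx c) z w != 0).

Definition top_pos (R : rcfType) (c : coeffs4 R) : Prop :=
  forall x y : R, (x, y) != (0, 0) -> 0 < top4_eval c x y.

Definition is_local_max (R : rcfType) (c : coeffs4 R) (x0 y0 : R) : Prop :=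
  exists2 e : R, 0 < e &
    forall x y : R, `|x - x0| < e -> `|y - y0| < e -> peval c x y <= peval c x0 y0.

Definition card_is (T : eqType) (P : T -> Prop) (n : nat) : Prop :=
  exists s : seq T, uniq s /\ size s = n /\ (forall t, t \in s <-> P t).

Definition num_real_crit (R : rcfType) (c : coeffs4 R) (M : nat) : Prop :=
  card_is (fun p : R * R => is_crit c p.1 p.2) M.

Definition num_local_max (R : rcfType) (c : coeffs4 R) (m : nat) : Prop :=
  card_is (fun p : R * R => is_local_max c p.1 p.2) m.

Definition realized_pairs : seq (nat * nat) :=
  [:: (1, 0); (3, 0); (5, 0); (7, 0); (9, 0); (3, 1); (5, 1); (7, 1); (9, 1)]%N.

(* Main.v *)
Require Import Defs.
From HB Require Import structures.
From mathcomp Require Import all_boot all_order all_algebra.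
From mathcomp Require Import reals.
From mathcomp Require Import complex.
From mathcomp Require Import boolp classical_sets functions polyrcf zify ring lra.
From mathcomp Require Import topology normedtype realfun derive.
Import Order.TTheory GRing.Theory Num.Theory.
Import numFieldNormedType.Exports.
Local Open Scope ring_scope.
Local Open Scope complex_scope.

(* Necessity.  After a generic shear the projection to the first coordinate is
   injective on the complex critical points.  Eliminating [y] from the two partial
   derivatives, by the determinant of multiplication by one of them modulo the
   other, gives a real polynomial of degree exactly 9: its top coefficient is the
   same determinant for the top forms, which have no common zero.  Its real roots
   are simple, because the critical points are nondegenerate, and correspond to
   the real critical points; so their number is odd and at most 9.  Restricting to
   the line through two local maxima gives a quartic with positive leading
   coefficient and two local maxima, which is impossible.  Finally the polynomial
   attains its minimum, so a local maximum is never the only critical point.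

   Sufficiency.  The critical points of [y^4 + 2 y^2 k(x) + h(x)] are the [(x, 0)]
   with [h'(x) = 0] and the [(x, y)] with [y^2 = - k(x)] and [(h - k^2)'(x) = 0].
   Each pair is realized by choosing [k] and [h] so that both cubics have explicit
   roots. *)

(** * Elimination *)

Section Norm.
Context {K : comRingType}.

(* Determinant of multiplication by [p1 y^2 + p2 y + p3] modulo
   [y^3 + q1 y^2 + q2 y + q3] in the basis [1, y, y^2]; [(a, b, c)] are the
   coordinates of [y (p1 y^2 + p2 y + p3)]. *)
Definition elim_norm (q1 q2 q3 p1 p2 p3 : K) : K :=
  let a := - (q3 * p1) in let b := p3 - q2 * p1 in let c := p2 - q1 * p1 in
  p3 * (b * (b - q1 * c) - c * (a - q2 * c))
  - p2 * (a * (b - q1 * c) - c * (- (q3 * c)))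
  + p1 * (a * (a - q2 * c) - b * (- (q3 * c))).

(** On polynomials modulo the cubic, multiplication by the quadratic has its values at [r], [s], [t]
    as eigenvalues, also when roots coincide. The determinant is thus the resultant of the two. *)
Lemma elim_norm_split (r s t p1 p2 p3 : K) :
  elim_norm (- (r + s + t)) (r * s + r * t + s * t) (- (r * s * t)) p1 p2 p3 =
  (p1 * r ^+ 2 + p2 * r + p3) * (p1 * s ^+ 2 + p2 * s + p3)
  * (p1 * t ^+ 2 + p2 * t + p3).
Proof. by rewrite /elim_norm; ring. Qed.

End Norm.

(** Dividing by [y - r] leaves the monic quadratic [y^2 + (q1 + r) y + q2 + r (q1 + r)]; [s] is one
    of its roots, and the sum of the roots gives [t]. *)
Lemma cubic_split_at (K : closedFieldType) (q1 q2 q3 r : K) :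
  r ^+ 3 + q1 * r ^+ 2 + q2 * r + q3 = 0 ->
  exists s t, [/\ q1 = - (r + s + t), q2 = r * s + r * t + s * t
                 & q3 = - (r * s * t)].
Proof.
move=> Hr; have [s Hs] := @solve_monicpoly K 2
  (nth 0 [:: - (q2 + r * (q1 + r)); - (q1 + r)]) isT.
move: Hs; rewrite !big_ord_recl !big_ord0 /= => Hs.
have E2 : q2 = - (s ^+ 2 + (q1 + r) * s) - r * (q1 + r) by rewrite Hs; ring.
exists s, (- (q1 + r) - s); split; first by ring.
  by rewrite {1}E2; ring.
have -> : q3 = - (r ^+ 3 + q1 * r ^+ 2 + q2 * r).
  by apply/eqP; rewrite -addr_eq0 addrC Hr.
by rewrite E2; ring.
Qed.

Lemma cubic_split (K : closedFieldType) (q1 q2 q3 : K) :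
  exists r s t, [/\ q1 = - (r + s + t), q2 = r * s + r * t + s * t
                 & q3 = - (r * s * t)].
Proof.
have [r] := @solve_monicpoly K 3 (nth 0 [:: - q3; - q2; - q1]) isT.
rewrite !big_ord_recl !big_ord0 /= => Hr.
have [|s [t H]] := cubic_split_at K q1 q2 q3 r; first by rewrite Hr; ring.
by exists r, s, t.
Qed.

Lemma cubic_factor (K : fieldType) (q1 q2 q3 r s t : K) :
  q1 = - (r + s + t) -> q2 = r * s + r * t + s * t ->
  q3 = - (r * s * t) ->
  forall y, y ^+ 3 + q1 * y ^+ 2 + q2 * y + q3 = (y - r) * (y - s) * (y - t).
Proof. by move=> -> -> -> y; ring. Qed.

(** * Degree and leading coefficient of the elimination determinant *)

Section WeightedDegree.
Context {K : idomainType}.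
Implicit Types p q : {poly K}.

(** Only a bound on the degree, with [c = 0] allowed, so that sums and products need no discussion
    of cancellation. *)
Definition top_coef n p (c : K) := (size p <= n.+1)%N /\ p`_n = c.

Lemma top_coefN n p c : top_coef n p c -> top_coef n (- p) (- c).
Proof. by case=> sp <-; split; rewrite ?size_polyN ?coefN. Qed.

Lemma top_coefD n p q c d :
  top_coef n p c -> top_coef n q d -> top_coef n (p + q) (c + d).
Proof.
move=> [sp <-] [sq <-]; split; last by rewrite coefD.
by apply: leq_trans (size_polyD _ _) _; rewrite geq_max sp sq.
Qed.

Lemma top_coefM n m k p q c d : k = (n + m)%N ->
  top_coef n p c -> top_coef m q d -> top_coef k (p * q) (c * d).
Proof.
move=> -> [sp <-] [sq <-]; split.
  apply: leq_trans (size_polyMleq _ _) _.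
  by move: sp sq; clear; lia.
have ln : (n < (n + m).+1)%N by rewrite ltnS leq_addr.
rewrite coefM (bigD1 (Ordinal ln)) //= addKn big1 ?addr0 // => i.
rewrite -val_eqE /= neq_ltn => /orP[lt_i|lt_i].
  rewrite [q`__]nth_default ?mulr0 //.
  by apply: leq_trans sq _; lia.
by rewrite [p`__]nth_default ?mul0r //; apply: leq_trans sp _.
Qed.

(** Give [q1], [q2], [q3] and [p1], [p2], [p3] the weights 1, 2, 3; then [a], [b], [c] have weights
    4, 3, 2 and the determinant is isobaric of weight 9. *)
Lemma top_coef_elim_norm (q1 q2 q3 p1 p2 p3 : {poly K}) a1 a2 a3 b1 b2 b3 :
  top_coef 1 q1 a1 -> top_coef 2 q2 a2 -> top_coef 3 q3 a3 ->
  top_coef 1 p1 b1 -> top_coef 2 p2 b2 -> top_coef 3 p3 b3 ->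
  top_coef 9 (elim_norm q1 q2 q3 p1 p2 p3) (elim_norm a1 a2 a3 b1 b2 b3).
Proof.
move=> Q1 Q2 Q3 P1 P2 P3; rewrite /elim_norm.
set a := - (q3 * p1); set b := p3 - q2 * p1; set c := p2 - q1 * p1.
set a' := - (a3 * b1); set b' := b3 - a2 * b1; set c' := b2 - a1 * b1.
have A : top_coef 4 a a' by apply/top_coefN/(@top_coefM 3 1).
have B : top_coef 3 b b'.
  by apply/top_coefD => //; apply/top_coefN/(@top_coefM 2 1).
have C : top_coef 2 c c'.
  by apply/top_coefD => //; apply/top_coefN/(@top_coefM 1 1).
have C0 : top_coef 5 (- (q3 * c)) (- (a3 * c')) by apply/top_coefN/(@top_coefM 3 2).
have C1 : top_coef 4 (a - q2 * c) (a' - a2 * c').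
  by apply/top_coefD => //; apply/top_coefN/(@top_coefM 2 2).
have C2 : top_coef 3 (b - q1 * c) (b' - a1 * c').
  by apply/top_coefD => //; apply/top_coefN/(@top_coefM 1 2).
apply/top_coefD; first apply/top_coefD.
- apply: (@top_coefM 3 6) => //; apply/top_coefD; first exact: (@top_coefM 3 3).
  by apply/top_coefN/(@top_coefM 2 4).
- apply/top_coefN/(@top_coefM 2 7) => //.
  apply/top_coefD; first exact: (@top_coefM 4 3).
  by apply/top_coefN/(@top_coefM 2 5).
apply: (@top_coefM 1 8) => //; apply/top_coefD; first exact: (@top_coefM 4 4).
by apply/top_coefN/(@top_coefM 3 5).
Qed.

End WeightedDegree.

Lemma elim_norm_map (K L : comNzRingType) (f : {rmorphism K -> L})
    (q1 q2 q3 p1 p2 p3 : K) :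
  f (elim_norm q1 q2 q3 p1 p2 p3) =
  elim_norm (f q1) (f q2) (f q3) (f p1) (f p2) (f p3).
Proof. by rewrite /elim_norm !(rmorphD, rmorphB, rmorphM, rmorphN). Qed.

Lemma horner_elim_norm (K : comNzRingType) (q1 q2 q3 p1 p2 p3 : {poly K}) z :
  (elim_norm q1 q2 q3 p1 p2 p3).[z] =
  elim_norm q1.[z] q2.[z] q3.[z] p1.[z] p2.[z] p3.[z].
Proof. by rewrite /elim_norm !hornerE. Qed.

(* [y, s, t] are the roots of the cubic at [z], with [y] also a root of
   [p = p1 Y^2 + p2 Y + p3]; [p1 (s + y) + p2] is the value at [s] of
   [p / (Y - y)], so that [y] may be a multiple root of the cubic. *)
Lemma deriv_elim_norm (K : comNzRingType) (q1 q2 q3 p1 p2 p3 : {poly K})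
    (z y s t : K) :
  q1.[z] = - (y + s + t) -> q2.[z] = y * s + y * t + s * t ->
  q3.[z] = - (y * s * t) ->
  p1.[z] * y ^+ 2 + p2.[z] * y + p3.[z] = 0 ->
  (elim_norm q1 q2 q3 p1 p2 p3)^`().[z] =
  (p1.[z] * (s + y) + p2.[z]) * (p1.[z] * (t + y) + p2.[z]) *
  ((y - s) * (y - t) * (p1^`().[z] * y ^+ 2 + p2^`().[z] * y + p3^`().[z])
   - (p1.[z] * y *+ 2 + p2.[z]) *
     (q1^`().[z] * y ^+ 2 + q2^`().[z] * y + q3^`().[z])).
Proof.
move=> e1 e2 e3 e4.
have e5 : p3.[z] = - (p1.[z] * y ^+ 2 + p2.[z] * y).
  by apply/eqP; rewrite -addr_eq0 addrC e4.
rewrite /elim_norm !(derivD, derivN, derivM) !(hornerD, hornerN, hornerM).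
rewrite e1 e2 e3 e5.
by ring.
Qed.

Definition pcomplex (R : rcfType) (p : {poly R}) : {poly R[i]} :=
  map_poly (real_complex R) p.

(** Dividing out the real roots leaves a cofactor [s] without real roots, since a root of [s] would
    be a multiple root of [p]. So [s] has even degree, whereas [p] has odd degree; [size] is the
    degree plus one. *)
Lemma odd_size_simple_roots (R : rcfType) (p : {poly R}) (xs : seq R) :
  uniq xs -> (forall x, (x \in xs) = root p x) ->
  (forall x, x \in xs -> ~~ root p^`() x) ->
  ~~ odd (size p) -> p != 0 -> odd (size xs) /\ (size xs < size p)%N.
Proof.
move=> Uxs Rxs Sxs odd_p p0.
have all_xs : all (root p) xs by apply/allP => x; rewrite Rxs.
split; last by apply: max_poly_roots; rewrite ?p0 // uniq_rootsE.
have [||s Es] := @uniq_roots_prod_XsubC _ p xs; rewrite ?uniq_rootsE //.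
have s0 : s != 0 by apply: contraNneq p0 => s0; rewrite Es s0 mul0r.
have sNroot x : ~~ root s x.
  apply/negP => sx.
  have px : x \in xs by rewrite Rxs Es rootM sx.
  have /negP := Sxs x px; apply.
  rewrite Es derivM rootE hornerD !hornerM (rootP sx) mul0r addr0.
  have : root (\prod_(z <- xs) ('X - z%:P)) x by rewrite root_prod_XsubC.
  by move=> /rootP ->; rewrite mulr0.
have : odd (size s).
  by apply/negPn/negP => /odd_poly_root [x]; apply/negP.
move: odd_p; rewrite Es size_Mmonic ?monic_prod_XsubC // size_prod_XsubC.
rewrite addnS /= oddD => H H'; move: H; rewrite H'.
by rewrite /= negbK.
Qed.

(** * The eliminant of a monic cubic and a quadratic in [w] *)

Section NormalForm.
Context {R : rcfType}.
Variables q1 q2 q3 p1 p2 p3 : {poly R}.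
Local Notation toC := (real_complex R).

Definition monic_cubic (z w : R[i]) : R[i] :=
  w ^+ 3 + (pcomplex R q1).[z] * w ^+ 2 + (pcomplex R q2).[z] * w
  + (pcomplex R q3).[z].

Definition rem_quadratic (z w : R[i]) : R[i] :=
  (pcomplex R p1).[z] * w ^+ 2 + (pcomplex R p2).[z] * w + (pcomplex R p3).[z].

Definition eliminant : {poly R} := elim_norm q1 q2 q3 p1 p2 p3.

Lemma pcomplex_eliminant : pcomplex R eliminant =
  elim_norm (pcomplex R q1) (pcomplex R q2) (pcomplex R q3)
            (pcomplex R p1) (pcomplex R p2) (pcomplex R p3).
Proof. exact: elim_norm_map. Qed.

(** Over [R[i]] the cubic at [z] splits, and the determinant is the product of the values of the
    quadratic at its three roots. *)
Lemma eliminantP z : root (pcomplex R eliminant) z <->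
  exists2 w, monic_cubic z w = 0 & rem_quadratic z w = 0.
Proof.
rewrite rootE pcomplex_eliminant horner_elim_norm /monic_cubic /rem_quadratic.
set a1 := (pcomplex R q1).[z]; set a2 := (pcomplex R q2).[z].
set a3 := (pcomplex R q3).[z]; set b1 := (pcomplex R p1).[z].
set b2 := (pcomplex R p2).[z]; set b3 := (pcomplex R p3).[z].
have [r [s [t [E1 E2 E3]]]] := @cubic_split _ a1 a2 a3.
have Q y := @cubic_factor _ a1 a2 a3 r s t E1 E2 E3 y.
rewrite E1 E2 E3 elim_norm_split !mulf_eq0 -!orbA -E1 -E2 -E3.
split=> [/or3P[] /eqP H|[w]].
- by exists r; rewrite // Q subrr !mul0r.
- by exists s; rewrite // Q subrr mulr0 mul0r.
- by exists t; rewrite // Q subrr mulr0.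
rewrite Q => /eqP; rewrite !mulf_eq0 -orbA !subr_eq0.
by case/or3P=> /eqP -> ->; rewrite eqxx ?orbT.
Qed.

Hypothesis size_q : [/\ size q1 <= 2, size q2 <= 3 & size q3 <= 4]%N.
Hypothesis size_p : [/\ size p1 <= 2, size p2 <= 3 & size p3 <= 4]%N.
(** The two top forms at [z = 1]. The top form of the monic cubic does not vanish at [(0, 1)], so
    this excludes every common zero at infinity. *)
Hypothesis top_coprime : forall w : R[i],
  w ^+ 3 + (q1`_1)%:C * w ^+ 2 + (q2`_2)%:C * w + (q3`_3)%:C = 0 ->
  (p1`_1)%:C * w ^+ 2 + (p2`_2)%:C * w + (p3`_3)%:C != 0.

Lemma size_eliminant : size eliminant = 10.
Proof.
case: size_q => Q1 Q2 Q3; case: size_p => P1 P2 P3.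
have [] : top_coef 9 eliminant
    (elim_norm q1`_1 q2`_2 q3`_3 p1`_1 p2`_2 p3`_3).
  by apply: top_coef_elim_norm; split.
move=> sz lead; apply/eqP; rewrite eqn_leq sz /= ltnNge; apply/negP => sz9.
(* If the degree dropped below 9, the determinant of the two top forms would be zero and they would
   share a root. *)
move: lead; rewrite nth_default // => /(congr1 toC) /esym/eqP.
rewrite rmorph0 elim_norm_map /=.
have [r [s [t [E1 E2 E3]]]] := @cubic_split _ (q1`_1)%:C (q2`_2)%:C (q3`_3)%:C.
have Q y := @cubic_factor _ _ _ _ r s t E1 E2 E3 y.
rewrite E1 E2 E3 elim_norm_split !mulf_eq0 -orbA.
by case/or3P; apply/negP; apply: top_coprime;
  rewrite Q subrr ?(mulr0, mul0r).
Qed.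

(** Transversality: the expression is the Jacobian determinant of the cubic and the quadratic with
    respect to [(w, z)]. *)
Hypothesis simple_zeros : forall z w : R[i],
  monic_cubic z w = 0 -> rem_quadratic z w = 0 ->
  (w ^+ 2 *+ 3 + (pcomplex R q1).[z] * w *+ 2 + (pcomplex R q2).[z]) *
  ((pcomplex R p1)^`().[z] * w ^+ 2 + (pcomplex R p2)^`().[z] * w
   + (pcomplex R p3)^`().[z])
  - ((pcomplex R p1).[z] * w *+ 2 + (pcomplex R p2).[z]) *
    ((pcomplex R q1)^`().[z] * w ^+ 2 + (pcomplex R q2)^`().[z] * w
     + (pcomplex R q3)^`().[z]) != 0.
Hypothesis inj_fst : forall z w w' : R[i],
  monic_cubic z w = 0 -> rem_quadratic z w = 0 ->
  monic_cubic z w' = 0 -> rem_quadratic z w' = 0 -> w = w'.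

(** By [deriv_elim_norm] the derivative is the Jacobian at the common root [r] times two factors,
    one for each other root [u] of the cubic, namely the quotient of the quadratic by [w - r]
    evaluated at [u]. *)
Lemma root_deriv_eliminant z :
  root (pcomplex R eliminant) z -> ~~ root (pcomplex R eliminant)^`() z.
Proof.
move=> /eliminantP [r Qr Pr]; apply/negP => /rootP.
rewrite pcomplex_eliminant => D0.
have := @simple_zeros z r Qr Pr; have := fun w => @inj_fst z r w Qr Pr.
move: D0 Qr Pr; rewrite /monic_cubic /rem_quadratic.
set a1 := (pcomplex R q1).[z]; set a2 := (pcomplex R q2).[z].
set a3 := (pcomplex R q3).[z]; set b1 := (pcomplex R p1).[z].
set b2 := (pcomplex R p2).[z]; set b3 := (pcomplex R p3).[z].
move=> D0 Qr Pr inj Jac.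
have [s [t [E1 E2 E3]]] := cubic_split_at _ a1 a2 a3 r Qr.
have Q y := @cubic_factor _ a1 a2 a3 r s t E1 E2 E3 y.
have Jac' : (r - s) * (r - t) *
    ((pcomplex R p1)^`().[z] * r ^+ 2 + (pcomplex R p2)^`().[z] * r
     + (pcomplex R p3)^`().[z])
    - (b1 * r *+ 2 + b2) * ((pcomplex R q1)^`().[z] * r ^+ 2
       + (pcomplex R q2)^`().[z] * r + (pcomplex R q3)^`().[z]) != 0.
  have -> : (r - s) * (r - t) = r ^+ 2 *+ 3 + a1 * r *+ 2 + a2.
    by rewrite E1 E2; ring.
  by [].
move: D0; rewrite (@deriv_elim_norm _ _ _ _ _ _ _ _ r s t) //.
move/eqP; rewrite mulf_eq0 (negPf Jac') orbF mulf_eq0.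
have factor u : b1 * (u + r) + b2 = 0 -> b1 * u ^+ 2 + b2 * u + b3 = 0.
  move=> H; rewrite -[LHS]subr0 -Pr.
  have -> : b1 * u ^+ 2 + b2 * u + b3 - (b1 * r ^+ 2 + b2 * r + b3) =
     (u - r) * (b1 * (u + r) + b2) by ring.
  by rewrite H mulr0.
case/orP => /eqP H.
(* A vanishing factor makes [s] a common root as well, so [s = r]; then both derivatives in [w]
   vanish at [r], and so does the Jacobian. *)
- have er : r = s by apply: inj; rewrite ?factor // Q subrr ?(mulr0, mul0r).
  move: Jac'; rewrite -er subrr !mul0r sub0r.
  have -> : b1 * r *+ 2 + b2 = b1 * (s + r) + b2 by rewrite -er; ring.
  by rewrite H mul0r oppr0 eqxx.
have er : r = t by apply: inj; rewrite ?factor // Q subrr ?(mulr0, mul0r).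
move: Jac'; rewrite -er subrr mulr0 !mul0r sub0r.
have -> : b1 * r *+ 2 + b2 = b1 * (t + r) + b2 by rewrite -er; ring.
by rewrite H mul0r oppr0 eqxx.
Qed.

Lemma conj_horner (p : {poly R}) (x : R) :
  conjc (pcomplex R p).[x%:C] = (pcomplex R p).[x%:C].
Proof. by rewrite /pcomplex horner_map; exact: conjc_real. Qed.

(** Complex conjugation preserves the set of common zeros over a real root of the eliminant; this
    set is a single point by [inj_fst], hence the point is real. So real roots and real zeros
    correspond. *)
Lemma odd_real_zeros (xs : seq R) : uniq xs ->
  (forall x, x \in xs <-> exists y : R,
      monic_cubic x%:C y%:C = 0 /\ rem_quadratic x%:C y%:C = 0) ->
  odd (size xs) /\ (size xs < 10)%N.
Proof.
move=> Uxs Hxs; rewrite -[X in (_ < X)%N]size_eliminant.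
have rootC x : root eliminant x = root (pcomplex R eliminant) x%:C.
  by rewrite fmorph_root.
apply: odd_size_simple_roots => //.
- move=> x; rewrite rootC; apply/idP/idP.
    by move/Hxs => [y [Qy Py]]; apply/eliminantP; exists y%:C.
  move=> /eliminantP [w Qw Pw]; apply/Hxs; exists (complex.Re w).
  suff -> : (complex.Re w)%:C = w by [].
  have ew : conjc w = w.
    apply: (@inj_fst x%:C) => //.
      have := congr1 (@conjc R) Qw.
      by rewrite /monic_cubic !(rmorphD, rmorphM, rmorphXn, rmorph0) /= !conj_horner.
    have := congr1 (@conjc R) Pw.
    by rewrite /rem_quadratic !(rmorphD, rmorphM, rmorphXn, rmorph0) /= !conj_horner.
  case: w ew {Qw Pw} => a b /= [] /eqP.
  by rewrite eqNr => /eqP ->.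
- move=> x /Hxs [y [Qy Py]].
  have : root (pcomplex R eliminant) x%:C by apply/eliminantP; exists y%:C.
  by move/root_deriv_eliminant; rewrite /pcomplex deriv_map fmorph_root.
- by rewrite size_eliminant.
by rewrite -size_poly_gt0 size_eliminant.
Qed.

(** Provides the finite list from which the directions to be avoided by the shear are computed: [z]
    is a root of the eliminant, and [w] a root of the cubic over it. *)
Lemma finite_zeros : exists zs : seq (R[i] * R[i]), forall z w,
  monic_cubic z w = 0 -> rem_quadratic z w = 0 -> (z, w) \in zs.
Proof.
have e0 : pcomplex R eliminant != 0.
  by rewrite map_poly_eq0 -size_poly_gt0 size_eliminant.
have [rs Ers] := closed_field_poly_normal (pcomplex R eliminant).
pose cub z : {poly R[i]} := 'X^3 + (pcomplex R q1).[z] *: 'X^2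
  + (pcomplex R q2).[z] *: 'X + (pcomplex R q3).[z]%:P.
exists (flatten [seq [seq (z, w) | w <- sval (closed_field_poly_normal (cub z))]
                | z <- rs]) => z w Qzw Pzw.
apply/flatten_mapP; exists z.
  have : root (pcomplex R eliminant) z by apply/eliminantP; exists w.
  by rewrite Ers rootZ ?lead_coef_eq0 // root_prod_XsubC.
apply/mapP; exists w => //.
case: closed_field_poly_normal => /= ws Ews.
have cub0 : cub z != 0.
  have : (cub z)`_3 = 1.
    by rewrite /cub !coefD !coefZ !coefXn coefX coefC /= !mulr0 !addr0.
  by apply: contra_eq_neq => ->; rewrite coef0 eq_sym oner_eq0.
have : root (cub z) w by apply/rootP; rewrite -[RHS]Qzw /cub
    !(hornerD, hornerZ, hornerXn, hornerX, hornerC).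
by rewrite Ews rootZ ?lead_coef_eq0 // root_prod_XsubC.
Qed.

End NormalForm.

(** * Reduction of the gradient to normal form *)

(** Indices in [nat] let the double sums unfold by computation and can be shifted by
    differentiation; the default value of [inord] above 4 is never reached in the expansions. *)
Definition cf {K : comNzRingType} (c : coeffs4 K) (i j : nat) : K :=
  c (inord i) (inord j).

Section Expansions.
Context {K : comRingType}.
Implicit Types (c : coeffs4 K) (z w : K).

Lemma pderiv_evalE c a b z w : pderiv_eval c a b z w =
  \sum_(0 <= i < 5) \sum_(0 <= j < 5)
    (if (i + j <= 4)%N
     then cf c i j * ((i ^_ a)%:R * (j ^_ b)%:R) * (z ^+ (i - a) * w ^+ (j - b))
     else 0).
Proof.
rewrite big_mkord; apply: eq_bigr => i _; rewrite big_mkord.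
by apply: eq_bigr => j _; rewrite /cf !inord_val.
Qed.

Lemma top4_evalE c z w : top4_eval c z w =
  cf c 4 0 * z ^+ 4 + cf c 3 1 * z ^+ 3 * w + cf c 2 2 * z ^+ 2 * w ^+ 2
  + cf c 1 3 * z * w ^+ 3 + cf c 0 4 * w ^+ 4.
Proof.
transitivity (\sum_(0 <= i < 5) \sum_(0 <= j < 5)
    (if (i + j == 4)%N then cf c i j * (z ^+ i * w ^+ j) else 0)).
  rewrite big_mkord; apply: eq_bigr => i _; rewrite big_mkord.
  by apply: eq_bigr => j _; rewrite /cf !inord_val.
by rewrite !unlock /=; ring.
Qed.

Let expand_nat := (ffactnS, ffactn0, ffact0n, subn0, subSS, sub0n, subnn).

Lemma pevalE c z w : peval c z w =
  cf c 0 0 + cf c 1 0 * z + cf c 0 1 * w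
  + cf c 2 0 * z ^+ 2 + cf c 1 1 * z * w + cf c 0 2 * w ^+ 2
  + cf c 3 0 * z ^+ 3 + cf c 2 1 * z ^+ 2 * w + cf c 1 2 * z * w ^+ 2
  + cf c 0 3 * w ^+ 3
  + cf c 4 0 * z ^+ 4 + cf c 3 1 * z ^+ 3 * w + cf c 2 2 * z ^+ 2 * w ^+ 2
  + cf c 1 3 * z * w ^+ 3 + cf c 0 4 * w ^+ 4.
Proof. by rewrite /peval pderiv_evalE !unlock /= !expand_nat /=; ring. Qed.

Lemma pderiv10E c z w : pderiv_eval c 1 0 z w =
  cf c 1 0 + cf c 2 0 * z *+ 2 + cf c 1 1 * w
  + cf c 3 0 * z ^+ 2 *+ 3 + cf c 2 1 * z * w *+ 2 + cf c 1 2 * w ^+ 2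
  + cf c 4 0 * z ^+ 3 *+ 4 + cf c 3 1 * z ^+ 2 * w *+ 3
  + cf c 2 2 * z * w ^+ 2 *+ 2 + cf c 1 3 * w ^+ 3.
Proof. by rewrite pderiv_evalE !unlock /= !expand_nat /=; ring. Qed.

Lemma pderiv01E c z w : pderiv_eval c 0 1 z w =
  cf c 0 1 + cf c 1 1 * z + cf c 0 2 * w *+ 2
  + cf c 2 1 * z ^+ 2 + cf c 1 2 * z * w *+ 2 + cf c 0 3 * w ^+ 2 *+ 3
  + cf c 3 1 * z ^+ 3 + cf c 2 2 * z ^+ 2 * w *+ 2
  + cf c 1 3 * z * w ^+ 2 *+ 3 + cf c 0 4 * w ^+ 3 *+ 4.
Proof. by rewrite pderiv_evalE !unlock /= !expand_nat /=; ring. Qed.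

Lemma pderiv20E c z w : pderiv_eval c 2 0 z w =
  cf c 2 0 *+ 2 + cf c 3 0 * z *+ 6 + cf c 2 1 * w *+ 2
  + cf c 4 0 * z ^+ 2 *+ 12 + cf c 3 1 * z * w *+ 6 + cf c 2 2 * w ^+ 2 *+ 2.
Proof. by rewrite pderiv_evalE !unlock /= !expand_nat /=; ring. Qed.

Lemma pderiv11E c z w : pderiv_eval c 1 1 z w =
  cf c 1 1 + cf c 2 1 * z *+ 2 + cf c 1 2 * w *+ 2
  + cf c 3 1 * z ^+ 2 *+ 3 + cf c 2 2 * z * w *+ 4 + cf c 1 3 * w ^+ 2 *+ 3.
Proof. by rewrite pderiv_evalE !unlock /= !expand_nat /=; ring. Qed.

Lemma pderiv02E c z w : pderiv_eval c 0 2 z w =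
  cf c 0 2 *+ 2 + cf c 1 2 * z *+ 2 + cf c 0 3 * w *+ 6
  + cf c 2 2 * z ^+ 2 *+ 2 + cf c 1 3 * z * w *+ 6 + cf c 0 4 * w ^+ 2 *+ 12.
Proof. by rewrite pderiv_evalE !unlock /= !expand_nat /=; ring. Qed.

End Expansions.

Lemma pderiv_eval_cplx (R : rcfType) (c : coeffs4 R) a b (x y : R) :
  pderiv_eval (cplx c) a b x%:C y%:C = (pderiv_eval c a b x y)%:C.
Proof.
rewrite /pderiv_eval rmorph_sum; apply: eq_bigr => i _.
rewrite rmorph_sum; apply: eq_bigr => j _.
case: ifP => _; last by rewrite rmorph0.
by rewrite !(rmorphM, rmorphXn, rmorph_nat).
Qed.

Lemma is_crit_cplx (R : rcfType) (c : coeffs4 R) (x y : R) :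
  is_crit (cplx c) x%:C y%:C <-> is_crit c x y.
Proof.
rewrite /is_crit !pderiv_eval_cplx.
by split=> [[/complexI -> /complexI ->]|[-> ->]].
Qed.

Section TopForm.
Context {K : numFieldType}.

(* The form is only known through its values, so the coefficients are recovered
   by interpolation at (1,0), (0,1), (1,1), (1,-1), (1,2) and (1,-2). *)
Lemma quartic_form_coef (a4 a3 a2 a1 a0 b4 b3 b2 b1 b0 : K) :
  (forall z w : K,
     a4 * z ^+ 4 + a3 * z ^+ 3 * w + a2 * z ^+ 2 * w ^+ 2 + a1 * z * w ^+ 3
     + a0 * w ^+ 4 =
     b4 * z ^+ 4 + b3 * z ^+ 3 * w + b2 * z ^+ 2 * w ^+ 2 + b1 * z * w ^+ 3
     + b0 * w ^+ 4) ->
  [/\ a4 = b4, a3 = b3, a2 = b2, a1 = b1 & a0 = b0].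
Proof.
move=> E.
have e4 : a4 = b4 by have := E 1 0; rewrite !(expr0n, mulr0, addr0) /= !expr1n !mulr1.
have e0 : a0 = b0.
  by have := E 0 1; rewrite !(expr0n, mulr0, mul0r, add0r) /= !expr1n !mulr1.
have E1 := E 1 1; have E2 := E 1 (-1); have E3 := E 1 2; have E4 := E 1 (-2).
have n2 : (2 : K) != 0 by rewrite pnatr_eq0.
have n12 : (12 : K) != 0 by rewrite pnatr_eq0.
have e2 : a2 = b2.
  apply: (mulfI n2); apply/eqP; rewrite -subr_eq0; apply/eqP.
  move: E1 E2; rewrite e4 e0 => /eqP; rewrite -subr_eq0 => /eqP E1 /eqP.
  rewrite -subr_eq0 => /eqP E2.
  by rewrite -[RHS]addr0 -{1}E1 -E2; ring.
have e1 : a1 = b1.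
  apply: (mulfI n12); apply/eqP; rewrite -subr_eq0; apply/eqP.
  move: E1 E2 E3 E4; rewrite e4 e0 e2.
  move=> /eqP; rewrite -subr_eq0 => /eqP E1 /eqP; rewrite -subr_eq0 => /eqP E2 /eqP.
  rewrite -subr_eq0 => /eqP E3 /eqP; rewrite -subr_eq0 => /eqP E4.
  (* The odd parts at [w = 1] and [w = 2] are [d3 + d1] and [2 d3 + 8 d1], where [d3], [d1] are the
     differences of coefficients; this combination eliminates [d3] and leaves [12 d1]. *)
  have -> : 0 = (0 - 0) - 2 * (0 - 0) :> K by ring.
  by rewrite -{1}E3 -{1}E4 -{1}E1 -{1}E2; ring.
split=> //; apply/eqP; rewrite -subr_eq0; apply/eqP.
move: E1; rewrite e4 e0 e2 e1 => /eqP; rewrite -subr_eq0 => /eqP <-.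
by ring.
Qed.

End TopForm.

Lemma indep_forms (K : fieldType) (p q p' q' z w : K) :
  p * q' - q * p' != 0 -> p * z + q * w = 0 -> p' * z + q' * w = 0 ->
  z = 0 /\ w = 0.
Proof.
move=> D H H'; split; apply: (mulfI D); rewrite mulr0.
  have -> : (p * q' - q * p') * z = q' * (p * z + q * w) - q * (p' * z + q' * w).
    by ring.
  by rewrite H H' !mulr0 subr0.
have -> : (p * q' - q * p') * w = p * (p' * z + q' * w) - p' * (p * z + q * w).
  by ring.
by rewrite H H' !mulr0 subr0.
Qed.

(* The two equations say that the gradient of the product vanishes at [(z, w)];
   where [p0 z + q0 w = 0] it is [(p0, q0)] times the other three factors. *)
Lemma product_form_grad (K : fieldType) (p0 q0 p1 q1 p2 q2 p3 q3 z w : K) :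
  let l0 := p0 * z + q0 * w in let l1 := p1 * z + q1 * w in
  let l2 := p2 * z + q2 * w in let l3 := p3 * z + q3 * w in
  p0 * q1 - q0 * p1 != 0 -> p0 * q2 - q0 * p2 != 0 -> p0 * q3 - q0 * p3 != 0 ->
  l0 = 0 ->
  p0 * (l1 * l2 * l3) + l0 * (p1 * l2 * l3 + p2 * l1 * l3 + p3 * l1 * l2) = 0 ->
  q0 * (l1 * l2 * l3) + l0 * (q1 * l2 * l3 + q2 * l1 * l3 + q3 * l1 * l2) = 0 ->
  z = 0 /\ w = 0.
Proof.
move=> l0 l1 l2 l3 D1 D2 D3 L0; rewrite L0 !mul0r !addr0 => Hp Hq.
have : l1 * l2 * l3 = 0.
  apply/eqP; apply: contraNT D1 => nz.
  move/eqP: Hp; rewrite mulf_eq0 (negPf nz) orbF => /eqP ->.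
  move/eqP: Hq; rewrite mulf_eq0 (negPf nz) orbF => /eqP ->.
  by rewrite !mul0r subr0.
move/eqP; rewrite !mulf_eq0 -orbA => /or3P[] /eqP L.
- exact: (indep_forms K p0 q0 p1 q1).
- exact: (indep_forms K p0 q0 p2 q2).
exact: (indep_forms K p0 q0 p3 q3).
Qed.

(** By Euler's identity a zero of the gradient is a zero of the form, so it lies on one of the four
    lines; there the gradient vanishes only if a second, independent linear factor does. *)
Lemma nondeg_top_grad (R : rcfType) (c : coeffs4 R) (z w : R[i]) :
  nondeg_top c ->
  let d := cf (cplx c) in
  d 4 0 * z ^+ 3 *+ 4 + d 3 1 * z ^+ 2 * w *+ 3 + d 2 2 * z * w ^+ 2 *+ 2
    + d 1 3 * w ^+ 3 = 0 ->
  d 3 1 * z ^+ 3 + d 2 2 * z ^+ 2 * w *+ 2 + d 1 3 * z * w ^+ 2 *+ 3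
    + d 0 4 * w ^+ 3 *+ 4 = 0 ->
  z = 0 /\ w = 0.
Proof.
move=> [p [q [Epq Dpq]]] d.
set o0 := (@Ordinal 4 0 isT); set o1 := (@Ordinal 4 1 isT).
set o2 := (@Ordinal 4 2 isT); set o3 := (@Ordinal 4 3 isT).
have E (x y : R[i]) : top4_eval (cplx c) x y =
    (p o0 * x + q o0 * y) * (p o1 * x + q o1 * y)
    * (p o2 * x + q o2 * y) * (p o3 * x + q o3 * y).
  rewrite Epq !big_ord_recr big_ord0 /= mul1r.
  by do !congr (_ * _); congr (_ + _); congr (_ * _); congr (_ _); apply: val_inj.
move: (Dpq o0 o1 isT) (Dpq o0 o2 isT) (Dpq o0 o3 isT) (Dpq o1 o0 isT)
  (Dpq o1 o2 isT) (Dpq o1 o3 isT) (Dpq o2 o0 isT) (Dpq o2 o1 isT) (Dpq o2 o3 isT)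
  (Dpq o3 o0 isT) (Dpq o3 o1 isT) (Dpq o3 o2 isT).
move: (p o0) (q o0) (p o1) (q o1) (p o2) (q o2) (p o3) (q o3) E.
move=> p0 q0 p1 q1 p2 q2 p3 q3 E {Dpq Epq p q o0 o1 o2 o3}.
move=> D01 D02 D03 D10 D12 D13 D20 D21 D23 D30 D31 D32.
have [E4 E3 E2 E1 E0] : [/\ d 4 0 = p0 * p1 * p2 * p3,
    d 3 1 = q0 * p1 * p2 * p3 + p0 * q1 * p2 * p3 + p0 * p1 * q2 * p3
            + p0 * p1 * p2 * q3,
    d 2 2 = q0 * q1 * p2 * p3 + q0 * p1 * q2 * p3 + q0 * p1 * p2 * q3
            + p0 * q1 * q2 * p3 + p0 * q1 * p2 * q3 + p0 * p1 * q2 * q3,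
    d 1 3 = p0 * q1 * q2 * q3 + q0 * p1 * q2 * q3 + q0 * q1 * p2 * q3
            + q0 * q1 * q2 * p3
    & d 0 4 = q0 * q1 * q2 * q3].
  apply: quartic_form_coef => x y.
  by rewrite -top4_evalE E; ring.
rewrite E4 E3 E2 E1 E0 => Hz Hw.
(* Euler's identity: [z] and [w] times the two partial derivatives add up to four times the form. *)
have : (p0 * z + q0 * w) * (p1 * z + q1 * w)
    * (p2 * z + q2 * w) * (p3 * z + q3 * w) *+ 4 = 0.
  rewrite -[RHS](addr0 0) -{1}(mulr0 z) -{1}Hz -(mulr0 w) -Hw.
  by ring.
move/eqP; rewrite mulrn_eq0 /= !mulf_eq0 -!orbA.
case/or4P => /eqP L.
- by apply: (product_form_grad _ p0 q0 p1 q1 p2 q2 p3 q3) => //;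
    [rewrite -[RHS]Hz|rewrite -[RHS]Hw]; ring.
- by apply: (product_form_grad _ p1 q1 p0 q0 p2 q2 p3 q3) => //;
    [rewrite -[RHS]Hz|rewrite -[RHS]Hw]; ring.
- by apply: (product_form_grad _ p2 q2 p0 q0 p1 q1 p3 q3) => //;
    [rewrite -[RHS]Hz|rewrite -[RHS]Hw]; ring.
by apply: (product_form_grad _ p3 q3 p0 q0 p1 q1 p2 q2) => //;
    [rewrite -[RHS]Hz|rewrite -[RHS]Hw]; ring.
Qed.

(** * The shear [(z, w) -> (z + t w, w)] and the normal form of a pair of cubics *)

Section Shear.
Context {K : comNzRingType}.
Implicit Types (g : nat -> nat -> K) (t z w : K).

Definition cubic_eval g z w : K :=
  g 0 0 + g 1 0 * z + g 0 1 * w + g 2 0 * z ^+ 2 + g 1 1 * z * w + g 0 2 * w ^+ 2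
  + g 3 0 * z ^+ 3 + g 2 1 * z ^+ 2 * w + g 1 2 * z * w ^+ 2 + g 0 3 * w ^+ 3.

Definition cubic_dx g z w : K :=
  g 1 0 + g 2 0 * z *+ 2 + g 1 1 * w
  + g 3 0 * z ^+ 2 *+ 3 + g 2 1 * z * w *+ 2 + g 1 2 * w ^+ 2.

Definition cubic_dy g z w : K :=
  g 0 1 + g 1 1 * z + g 0 2 * w *+ 2
  + g 2 1 * z ^+ 2 + g 1 2 * z * w *+ 2 + g 0 3 * w ^+ 2 *+ 3.

Definition cubic_top g z w : K :=
  g 3 0 * z ^+ 3 + g 2 1 * z ^+ 2 * w + g 1 2 * z * w ^+ 2 + g 0 3 * w ^+ 3.

(* [shear_k g t] is the coefficient of [w ^+ k] in [g (z + t w, w)], as a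
   polynomial in [z]. *)
Definition shear3 g t : K := cubic_top g t 1.
Definition shear2 g t : {poly K} :=
  (g 3 0 * t ^+ 2 *+ 3 + g 2 1 * t *+ 2 + g 1 2) *: 'X
  + (g 2 0 * t ^+ 2 + g 1 1 * t + g 0 2)%:P.
Definition shear1 g t : {poly K} :=
  (g 3 0 * t *+ 3 + g 2 1) *: 'X^2 + (g 2 0 * t *+ 2 + g 1 1) *: 'X
  + (g 1 0 * t + g 0 1)%:P.
Definition shear0 g : {poly K} :=
  g 3 0 *: 'X^3 + g 2 0 *: 'X^2 + g 1 0 *: 'X + (g 0 0)%:P.

Let hE := (hornerD, hornerZ, hornerXn, hornerX, hornerC).

Lemma shear_eval g t z w :
  shear3 g t * w ^+ 3 + (shear2 g t).[z] * w ^+ 2 + (shear1 g t).[z] * w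
  + (shear0 g).[z] = cubic_eval g (z + t * w) w.
Proof.
by rewrite /shear3 /shear2 /shear1 /shear0 /cubic_top /cubic_eval !hE; ring.
Qed.

Lemma shear_dx g t z w :
  (shear2 g t)^`().[z] * w ^+ 2 + (shear1 g t)^`().[z] * w + (shear0 g)^`().[z] =
  cubic_dx g (z + t * w) w.
Proof.
rewrite /shear2 /shear1 /shear0 /cubic_dx !(derivD, derivZ, derivXn, derivX, derivC).
by rewrite !(hornerD, hornerMn, hE) /=; ring.
Qed.

Lemma shear_dy g t z w :
  shear3 g t * w ^+ 2 *+ 3 + (shear2 g t).[z] * w *+ 2 + (shear1 g t).[z] =
  t * cubic_dx g (z + t * w) w + cubic_dy g (z + t * w) w.
Proof.
rewrite /shear3 /shear2 /shear1 /cubic_top /cubic_dx /cubic_dy !hE.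
by ring.
Qed.

Lemma shear_top g t w :
  shear3 g t * w ^+ 3 + (shear2 g t)`_1 * w ^+ 2 + (shear1 g t)`_2 * w
  + (shear0 g)`_3 = cubic_top g (1 + t * w) w.
Proof.
rewrite /shear3 /shear2 /shear1 /shear0 /cubic_top.
by rewrite !(coefD, coefZ, coefXn, coefX, coefC) /=; ring.
Qed.

Lemma size_shear g t : [/\ (size (shear2 g t) <= 2)%N, (size (shear1 g t) <= 3)%N
  & (size (shear0 g) <= 4)%N].
Proof.
rewrite /shear2 /shear1 /shear0; split; apply/leq_sizeP => -[|[|[|[|j]]]] //= _;
  by rewrite !(coefD, coefZ, coefXn, coefX, coefC) /= !(mulr0, addr0).
Qed.

(* A pair of cubics, made monic in [w] (resp. of degree at most 2 in [w]) after
   the shear; [u] stands for the inverse of [shear3 hQ t]. *)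
Definition nf_q k hQ u t : {poly K} :=
  u *: (if k is 0 then shear0 hQ else if k is 1 then shear1 hQ t else shear2 hQ t).
Definition nf_p k hP hQ u t : {poly K} :=
  (if k is 0 then shear0 hP else if k is 1 then shear1 hP t else shear2 hP t)
  - shear3 hP t *: nf_q k hQ u t.

Lemma nf_q_eval hQ u t z w : u * shear3 hQ t = 1 ->
  w ^+ 3 + (nf_q 2 hQ u t).[z] * w ^+ 2 + (nf_q 1 hQ u t).[z] * w
  + (nf_q 0 hQ u t).[z] = u * cubic_eval hQ (z + t * w) w.
Proof.
move=> E; rewrite -shear_eval /nf_q !hornerZ -[X in X + _ + _ + _ = _]mul1r -E.
by ring.
Qed.

Lemma nf_p_eval hP hQ u t z w : u * shear3 hQ t = 1 ->
  (nf_p 2 hP hQ u t).[z] * w ^+ 2 + (nf_p 1 hP hQ u t).[z] * w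
  + (nf_p 0 hP hQ u t).[z] =
  cubic_eval hP (z + t * w) w
  - shear3 hP t * (u * cubic_eval hQ (z + t * w) w).
Proof.
move=> E; rewrite -nf_q_eval // -shear_eval /nf_p !(hornerD, hornerN, hornerZ).
by ring.
Qed.

Lemma nf_q_top hQ u t w : u * shear3 hQ t = 1 ->
  w ^+ 3 + (nf_q 2 hQ u t)`_1 * w ^+ 2 + (nf_q 1 hQ u t)`_2 * w
  + (nf_q 0 hQ u t)`_3 = u * cubic_top hQ (1 + t * w) w.
Proof.
move=> E; rewrite -shear_top /nf_q !coefZ -[X in X + _ + _ + _ = _]mul1r -E.
by ring.
Qed.

Lemma nf_p_top hP hQ u t w : u * shear3 hQ t = 1 ->
  (nf_p 2 hP hQ u t)`_1 * w ^+ 2 + (nf_p 1 hP hQ u t)`_2 * w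
  + (nf_p 0 hP hQ u t)`_3 =
  cubic_top hP (1 + t * w) w - shear3 hP t * (u * cubic_top hQ (1 + t * w) w).
Proof.
move=> E; rewrite -nf_q_top // -shear_top /nf_p !(coefB, coefZ).
by ring.
Qed.

(** The shear has determinant 1, subtracting a constant multiple of one equation from the other
    preserves the Jacobian, and scaling by [u] gives the factor [u]. *)
Lemma nf_jacobian hP hQ u t z w : u * shear3 hQ t = 1 ->
  (w ^+ 2 *+ 3 + (nf_q 2 hQ u t).[z] * w *+ 2 + (nf_q 1 hQ u t).[z]) *
  ((nf_p 2 hP hQ u t)^`().[z] * w ^+ 2 + (nf_p 1 hP hQ u t)^`().[z] * w
   + (nf_p 0 hP hQ u t)^`().[z])
  - ((nf_p 2 hP hQ u t).[z] * w *+ 2 + (nf_p 1 hP hQ u t).[z]) *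
    ((nf_q 2 hQ u t)^`().[z] * w ^+ 2 + (nf_q 1 hQ u t)^`().[z] * w
     + (nf_q 0 hQ u t)^`().[z])
  = u * (cubic_dx hP (z + t * w) w * cubic_dy hQ (z + t * w) w
         - cubic_dy hP (z + t * w) w * cubic_dx hQ (z + t * w) w).
Proof.
move=> E; have dQ := shear_dy hQ t z w; have dP := shear_dy hP t z w.
have xQ := shear_dx hQ t z w; have xP := shear_dx hP t z w.
have -> : cubic_dy hQ (z + t * w) w = shear3 hQ t * w ^+ 2 *+ 3 +
    (shear2 hQ t).[z] * w *+ 2 + (shear1 hQ t).[z]
    - t * cubic_dx hQ (z + t * w) w by rewrite dQ; ring.
have -> : cubic_dy hP (z + t * w) w =
    shear3 hP t * (u * shear3 hQ t) * w ^+ 2 *+ 3 +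
    (shear2 hP t).[z] * w *+ 2 + (shear1 hP t).[z]
    - t * cubic_dx hP (z + t * w) w by rewrite E mulr1 dP; ring.
rewrite -xQ -xP /nf_p /nf_q !(derivD, derivN, derivZ) !(hornerD, hornerN, hornerZ).
by rewrite -[X in (X + _ + _) * _ - _ = _]mul1r -E; ring.
Qed.

Lemma size_nf hP hQ u t :
  [/\ (size (nf_q 2 hQ u t) <= 2)%N, (size (nf_q 1 hQ u t) <= 3)%N
    & (size (nf_q 0 hQ u t) <= 4)%N] /\
  [/\ (size (nf_p 2 hP hQ u t) <= 2)%N, (size (nf_p 1 hP hQ u t) <= 3)%N
    & (size (nf_p 0 hP hQ u t) <= 4)%N].
Proof.
have [Q2 Q1 Q0] := size_shear hQ t; have [P2 P1 P0] := size_shear hP t.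
have sZ (a : K) (p : {poly K}) n : (size p <= n)%N -> (size (a *: p) <= n)%N.
  by apply: leq_trans (size_scale_leq _ _).
have sB n (p q : {poly K}) : (size p <= n)%N -> (size q <= n)%N ->
    (size (p - q)%R <= n)%N.
  by move=> sp sq; apply: leq_trans (size_polyD _ _) _; rewrite geq_max size_polyN sp.
by split; split; rewrite /nf_p /nf_q;
  [exact: sZ|exact: sZ|exact: sZ|apply: sB..]; rewrite // sZ // sZ.
Qed.

End Shear.

Lemma pcomplex_shear (R : rcfType) (g : nat -> nat -> R) t 
    (h := fun i j => (g i j)%:C) :
  [/\ (shear3 g t)%:C = shear3 h t%:C,
      pcomplex R (shear2 g t) = shear2 h t%:C,
      pcomplex R (shear1 g t) = shear1 h t%:C
    & pcomplex R (shear0 g) = shear0 h].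
Proof.
rewrite /pcomplex /shear3 /shear2 /shear1 /shear0 /cubic_top /h.
by split; do 3 rewrite ?(rmorphD, rmorphM, rmorphMn, rmorphXn, rmorph1, map_polyZ,
  map_polyC, map_polyX) /=.
Qed.

Lemma pcomplex_nf (R : rcfType) (gP gQ : nat -> nat -> R) u t k
    (hP := fun i j => (gP i j)%:C) (hQ := fun i j => (gQ i j)%:C) :
  pcomplex R (nf_q k gQ u t) = nf_q k hQ u%:C t%:C /\
  pcomplex R (nf_p k gP gQ u t) = nf_p k hP hQ u%:C t%:C.
Proof.
have [P3 P2 P1 P0] := pcomplex_shear R gP t.
have [_ Q2 Q1 Q0] := pcomplex_shear R gQ t.
have E p q a : pcomplex R (p - a *: q) = pcomplex R p - a%:C *: pcomplex R q.
  by rewrite /pcomplex rmorphB /= map_polyZ.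
have F p a : pcomplex R (a *: p) = a%:C *: pcomplex R p.
  by rewrite /pcomplex map_polyZ.
rewrite /nf_p /nf_q E !F P3.
by case: k => [|[|k]]; rewrite ?P2 ?P1 ?P0 ?Q2 ?Q1 ?Q0.
Qed.

(** * Real zeros of a pair of plane cubics *)

Section CubicPair.
Context {R : rcfType}.
Variables (gP gQ : nat -> nat -> R) (t : R).
Local Notation hP := (fun i j : nat => (gP i j)%:C).
Local Notation hQ := (fun i j : nat => (gQ i j)%:C).
Local Notation u := ((shear3 gQ t)^-1).
Local Notation q k := (nf_q k gQ u t).
Local Notation p k := (nf_p k gP gQ u t).

Hypothesis lead_neq0 : shear3 gQ t != 0.

Let leadC : u%:C * shear3 hQ t%:C = 1.
Proof.
have [<- _ _ _] := pcomplex_shear R gQ t.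
by rewrite -rmorphM mulVf.
Qed.

Let u_neq0 : u%:C != 0.
Proof. by rewrite (inj_eq (@complexI R) _ 0) invr_eq0. Qed.

Let monicE z w : monic_cubic (q 2) (q 1) (q 0) z w =
  u%:C * cubic_eval hQ (z + t%:C * w) w.
Proof.
rewrite -(nf_q_eval _ _ _ _ _ leadC) /monic_cubic.
by rewrite !(pcomplex_nf R gP gQ _ _ _).1.
Qed.

Let remE z w : rem_quadratic (p 2) (p 1) (p 0) z w =
  cubic_eval hP (z + t%:C * w) w
  - shear3 hP t%:C * (u%:C * cubic_eval hQ (z + t%:C * w) w).
Proof.
rewrite -(nf_p_eval _ _ _ _ _ _ leadC) /rem_quadratic.
by rewrite !(pcomplex_nf R gP gQ _ _ _).2.
Qed.

Let zerosE z w :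
  (monic_cubic (q 2) (q 1) (q 0) z w = 0 /\
   rem_quadratic (p 2) (p 1) (p 0) z w = 0) <->
  (cubic_eval hP (z + t%:C * w) w = 0 /\ cubic_eval hQ (z + t%:C * w) w = 0).
Proof.
rewrite monicE remE; split=> -[].
  move=> /eqP; rewrite mulf_eq0 (negPf u_neq0) /= => /eqP ->.
  by rewrite !mulr0 subr0.
by move=> -> ->; rewrite !mulr0 subr0.
Qed.

Hypothesis top_coprime : forall z w : R[i],
  cubic_top hP z w = 0 -> cubic_top hQ z w = 0 -> z = 0 /\ w = 0.

Let top_coprime_nf (w : R[i]) :
  w ^+ 3 + ((q 2)`_1)%:C * w ^+ 2 + ((q 1)`_2)%:C * w + ((q 0)`_3)%:C = 0 ->
  ((p 2)`_1)%:C * w ^+ 2 + ((p 1)`_2)%:C * w + ((p 0)`_3)%:C != 0.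
Proof.
have coefC (f : {poly R}) i : (f`_i)%:C = (pcomplex R f)`_i.
  by rewrite /pcomplex coef_map.
rewrite !coefC !(pcomplex_nf R gP gQ _ _ _).1 !(pcomplex_nf R gP gQ _ _ _).2.
rewrite (nf_q_top _ _ _ _ leadC) (nf_p_top _ _ _ _ _ leadC) => T1.
rewrite T1; move/eqP: T1; rewrite mulf_eq0 (negPf u_neq0) /= mulr0 subr0.
move=> /eqP T1; apply/eqP => T2.
have [+ w0] := top_coprime _ _ T2 T1.
by rewrite w0 mulr0 addr0 => /eqP; rewrite oner_eq0.
Qed.

Lemma finite_cubic_zeros : exists zs : seq (R[i] * R[i]), forall z w,
  cubic_eval hP z w = 0 -> cubic_eval hQ z w = 0 -> (z, w) \in zs.
Proof.
have [zs Hzs] := @finite_zeros R _ _ _ _ _ _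
  (size_nf gP gQ u t).1 (size_nf gP gQ u t).2 top_coprime_nf.
exists [seq (a.1 + t%:C * a.2, a.2) | a <- zs] => z w Pzw Qzw.
have [|] := (zerosE (z - t%:C * w) w).2; first by rewrite subrK.
move=> H1 H2; apply/mapP; exists (z - t%:C * w, w); first exact: Hzs.
by rewrite subrK.
Qed.

Hypothesis simple_zeros : forall z w : R[i],
  cubic_eval hP z w = 0 -> cubic_eval hQ z w = 0 ->
  cubic_dx hP z w * cubic_dy hQ z w - cubic_dy hP z w * cubic_dx hQ z w != 0.
Hypothesis inj_proj : forall z w z' w' : R[i],
  cubic_eval hP z w = 0 -> cubic_eval hQ z w = 0 ->
  cubic_eval hP z' w' = 0 -> cubic_eval hQ z' w' = 0 ->
  z - t%:C * w = z' - t%:C * w' -> w = w'.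

Lemma odd_cubic_zeros (xs : seq (R * R)) : uniq xs ->
  (forall a, a \in xs <->
     cubic_eval gP a.1 a.2 = 0 /\ cubic_eval gQ a.1 a.2 = 0) ->
  odd (size xs) /\ (size xs < 10)%N.
Proof.
move=> Uxs Hxs.
have realE (g : nat -> nat -> R) x y :
    cubic_eval (fun i j => (g i j)%:C) x%:C y%:C = (cubic_eval g x y)%:C.
  by rewrite /cubic_eval !(rmorphD, rmorphM, rmorphXn).
have cub0 a : a \in xs <->
    cubic_eval hP a.1%:C a.2%:C = 0 /\ cubic_eval hQ a.1%:C a.2%:C = 0.
  rewrite !realE; split; first by move/Hxs => [-> ->].
  by case=> /complexI ? /complexI ?; apply/Hxs.
(* [x - t y] is the first coordinate after undoing the shear; by [inj_proj] it separates the zeros,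
   so the number of values is the number of zeros. *)
rewrite -(size_map (fun a : R * R => a.1 - t * a.2) xs).
apply: (@odd_real_zeros R _ _ _ _ _ _
  (size_nf gP gQ u t).1 (size_nf gP gQ u t).2 top_coprime_nf).
- move=> z w Qzw Pzw; have [Pz Qz] := (zerosE z w).1 (conj Qzw Pzw).
  rewrite !(pcomplex_nf R gP gQ _ _ _).1 !(pcomplex_nf R gP gQ _ _ _).2.
  by rewrite (nf_jacobian _ _ _ _ _ _ leadC) mulf_neq0 // simple_zeros.
- move=> z w w' Q1 P1 Q2 P2.
  have [Pz Qz] := (zerosE z w).1 (conj Q1 P1).
  have [Pz' Qz'] := (zerosE z w').1 (conj Q2 P2).
  by apply: (inj_proj _ _ _ _ Pz Qz Pz' Qz'); rewrite !addrK.
- rewrite map_inj_in_uniq // => -[x y] [x' y'] /cub0 /= [P1 Q1] /cub0 /= [P2 Q2].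
  move=> E; have Ey : y = y'.
    apply: complexI; apply: (inj_proj _ _ _ _ P1 Q1 P2 Q2).
    by rewrite -!rmorphM -!rmorphB E.
  by move: E; rewrite Ey => /subIr ->.
move=> x; split.
  move=> /mapP [[a y] /cub0 /= [P1 Q1] ->]; exists y.
  by apply/zerosE; rewrite -rmorphM -rmorphD subrK.
move=> [y /zerosE]; rewrite -rmorphM -rmorphD => H.
apply/mapP; exists (x + t * y, y); last by rewrite /= addrK.
by apply/cub0.
Qed.

End CubicPair.

Lemma avoid_nat (K : numDomainType) (s : seq K) : exists n : nat, n%:R \notin s.
Proof.
have inj : injective (fun n : nat => n%:R : K).
  by move=> m n /eqP; rewrite eqr_nat => /eqP.
have : ~~ all (mem s) [seq i%:R | i <- iota 0 (size s).+1].
  apply/negP => /allP sub.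
  have U : uniq [seq i%:R : K | i <- iota 0 (size s).+1].
    by rewrite (map_inj_uniq inj) iota_uniq.
  have := uniq_leq_size U sub.
  by rewrite size_map size_iota ltnn.
by case/allPn => _ /mapP [n _ ->]; exists n.
Qed.

Definition gradx {K : comNzRingType} (c : coeffs4 K) (i j : nat) : K :=
  cf c i.+1 j *+ i.+1.
Definition grady {K : comNzRingType} (c : coeffs4 K) (i j : nat) : K :=
  cf c i j.+1 *+ j.+1.

Section Gradient.
Context {K : comNzRingType}.
Implicit Types (d : coeffs4 K) (g h : nat -> nat -> K).

Lemma pderiv10_cubic d z w : pderiv_eval d 1 0 z w = cubic_eval (gradx d) z w.
Proof. by rewrite pderiv10E /cubic_eval /gradx; ring. Qed.

Lemma pderiv01_cubic d z w : pderiv_eval d 0 1 z w = cubic_eval (grady d) z w.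
Proof. by rewrite pderiv01E /cubic_eval /grady; ring. Qed.

Lemma hess_det_cubic d z w : hess_det d z w =
  cubic_dx (gradx d) z w * cubic_dy (grady d) z w
  - cubic_dy (gradx d) z w * cubic_dx (grady d) z w.
Proof.
rewrite /hess_det pderiv20E pderiv11E pderiv02E /cubic_dx /cubic_dy /gradx /grady.
by ring.
Qed.

Lemma cubic_combine (t : K) g h z w (f := fun i j => t * g i j + h i j) :
  [/\ cubic_eval f z w = t * cubic_eval g z w + cubic_eval h z w,
      cubic_dx f z w = t * cubic_dx g z w + cubic_dx h z w,
      cubic_dy f z w = t * cubic_dy g z w + cubic_dy h z w
    & cubic_top f z w = t * cubic_top g z w + cubic_top h z w].
Proof.
by split; rewrite /f /cubic_eval /cubic_dx /cubic_dy /cubic_top; ring.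
Qed.

Lemma top4_euler d z w :
  z * cubic_top (gradx d) z w + w * cubic_top (grady d) z w = top4_eval d z w *+ 4.
Proof. by rewrite top4_evalE /cubic_top /gradx /grady; ring. Qed.

End Gradient.

Lemma odd_num_real_crit (R : rcfType) (c : coeffs4 R) M :
  morse4 c -> top_pos c -> num_real_crit c M -> odd M /\ (M < 10)%N.
Proof.
move=> [nd smooth] pos [xs [Uxs [<- Hxs]]].
(* The derivative in [w] of the sheared polynomial. By Euler's identity its coefficient of [w^3] is
   four times the top form at [(t, 1)], which is positive for every real [t]. *)
pose gQ (t : R) i j := t * gradx c i j + grady c i j.
pose gPC := gradx (cplx c).
pose gQC (t : R) i j := t%:C * gradx (cplx c) i j + grady (cplx c) i j.
have EP : (fun i j => (gradx c i j)%:C) = gPC.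
  by apply/funext => i; apply/funext => j; rewrite /gPC /gradx rmorphMn.
have EQ t : (fun i j => (gQ t i j)%:C) = gQC t.
  apply/funext => i; apply/funext => j.
  by rewrite /gQC /gQ /gradx /grady rmorphD rmorphM !rmorphMn.
have lead t : shear3 (gQ t) t != 0.
  have [_ _ _ E] := cubic_combine t (gradx c) (grady c) t 1.
  rewrite /shear3 E -[X in _ + X]mul1r top4_euler mulrn_eq0 /= gt_eqF //.
  by apply: pos; rewrite xpair_eqE oner_eq0 andbF.
have top t z w : cubic_top (fun i j => (gradx c i j)%:C) z w = 0 ->
    cubic_top (fun i j => (gQ t i j)%:C) z w = 0 -> z = 0 /\ w = 0.
  rewrite EP EQ; have [_ _ _ ->] := cubic_combine t%:C gPC (grady (cplx c)) z w.
  move=> T1; rewrite T1 mulr0 add0r => T2.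
  apply: (nondeg_top_grad _ c) => //.
    by rewrite -[RHS]T1 /cubic_top /gPC /gradx; ring.
  by rewrite -[RHS]T2 /cubic_top /grady; ring.
have critE t z w : (cubic_eval (fun i j => (gradx c i j)%:C) z w = 0 /\
    cubic_eval (fun i j => (gQ t i j)%:C) z w = 0) <-> is_crit (cplx c) z w.
  rewrite EP EQ; have [-> _ _ _] := cubic_combine t%:C gPC (grady (cplx c)) z w.
  rewrite /is_crit pderiv10_cubic pderiv01_cubic.
  by split=> -[->]; rewrite mulr0 add0r.
have [zs Hzs] := finite_cubic_zeros (gradx c) (gQ 0) 0 (lead 0) (top 0).
(* Values of [t] for which two critical points get the same first coordinate. Pairs with equal
   second coordinates contribute the value 0 of a division by zero, which only enlarges the list. *)
pose bad := [seq (a.1 - b.1) / (a.2 - b.2) | a <- zs, b <- zs].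
(* The values to avoid are complex while [t] has to be real; a natural number serves in both
   fields. *)
have [n nP] := avoid_nat _ bad; pose t : R := n%:R.
have tC : t%:C = n%:R by rewrite rmorph_nat.
apply: (odd_cubic_zeros (gradx c) (gQ t) t (lead t) (top t)) => //.
- move=> z w P0 Q0; have := smooth z w ((critE t z w).1 (conj P0 Q0)).
  rewrite hess_det_cubic EP EQ; apply: contra_neq.
  have [_ -> -> _] := cubic_combine t%:C gPC (grady (cplx c)) z w => E.
  by rewrite -[RHS]E /gPC; ring.
- move=> z w z' w' P1 Q1 P2 Q2 E; apply/eqP; apply: contraNT nP => neq.
  have mem a b : cubic_eval (fun i j => (gradx c i j)%:C) a b = 0 ->
      cubic_eval (fun i j => (gQ t i j)%:C) a b = 0 -> (a, b) \in zs.
    move=> H1 H2; have [] := (critE 0 a b).2 ((critE t a b).1 (conj H1 H2)).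
    exact: Hzs.
  apply/allpairsP; exists ((z, w), (z', w')); split; rewrite ?mem //= -tC.
  have d0 : w - w' != 0 by rewrite subr_eq0.
  apply: (mulIf d0); rewrite divfK // mulrBr.
  have -> : z = z' - t%:C * w' + t%:C * w by rewrite -E subrK.
  by move: t%:C => T; ring.
move=> [x y]; rewrite Hxs /= -is_crit_cplx -(critE t).
have realE (g : nat -> nat -> R) :
    cubic_eval (fun i j => (g i j)%:C) x%:C y%:C = (cubic_eval g x y)%:C.
  by rewrite /cubic_eval !(rmorphD, rmorphM, rmorphXn).
rewrite !realE; split; last by move=> [-> ->].
by move=> [/complexI -> /complexI ->].
Qed.

(** * Local maxima and the global minimum *)

Section SmallParameter.
Context {R : realFieldType}.
Implicit Types a b c d e t : R.

Lemma cubic_limit_le0 a b c d e : 0 < e ->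
  (forall t, 0 < t < e -> a * t ^+ 3 + b * t ^+ 2 + c * t + d <= 0) -> d <= 0.
Proof.
move=> e0 H; rewrite leNgt; apply/negP => d0.
pose S := `|a| + `|b| + `|c| + 1.
have S0 : 0 < S by rewrite /S ltr_wpDl // !addr_ge0.
(* [t <= 1] bounds the nonconstant terms by [S t] in absolute value, and [t <= d / (2 S)] makes this
   at most [d / 2]. *)
pose t := Num.min (e / 2) (Num.min 1 (d / (2 * S))).
have t0 : 0 < t by rewrite !lt_min ltr01 !divr_gt0 ?mulr_gt0.
have te : t < e.
  by apply: (@le_lt_trans _ _ (e / 2)); [rewrite ge_min lexx|lra].
have t1 : t <= 1 by rewrite !ge_min lexx orbT.
have tS : t * S <= d / 2.
  rewrite -ler_pdivlMr //; apply: (@le_trans _ _ (d / (2 * S))).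
    by rewrite !ge_min lexx !orbT.
  by rewrite invfM mulrA.
have bnd (x : R) n : - (`|x| * t) <= x * t ^+ n.+1.
  rewrite lerNl; apply: le_trans (ler_norm _) _.
  rewrite normrN normrM ler_wpM2l // ger0_norm ?exprn_ge0 ?(ltW t0) //.
  by rewrite exprS ler_piMr ?exprn_ile1 ?(ltW t0).
have := H t; rewrite t0 te => /(_ isT).
have := bnd a 2%N; have := bnd b 1%N; have := bnd c 0%N; rewrite expr1.
by move: tS; rewrite /S !mulrDr mulr1; lra.
Qed.

(** The first and second order conditions at 0: dividing by [t], at [t] and at [- t], and then by
    [t^2] reduces them to [cubic_limit_le0]. *)
Lemma quartic_local_max a b c d e : 0 < e ->
  (forall t, `|t| < e -> a * t ^+ 4 + b * t ^+ 3 + c * t ^+ 2 + d * t <= 0) ->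
  d = 0 /\ c <= 0.
Proof.
move=> e0 H.
have d0 : d = 0.
  apply/eqP; rewrite eq_le; apply/andP; split.
    apply: (@cubic_limit_le0 a b c d e) => // t /andP[t0 te].
    rewrite -(@pmulr_lle0 _ t) //.
    have := H t; rewrite gtr0_norm // => /(_ te); congr (_ <= 0); ring.
  rewrite -oppr_le0; apply: (@cubic_limit_le0 a (- b) c (- d) e) => // t /andP[t0 te].
  rewrite -(@pmulr_lle0 _ t) //.
  have := H (- t); rewrite normrN gtr0_norm // => /(_ te); congr (_ <= 0); ring.
split=> //; apply: (@cubic_limit_le0 0 a b c e) => // t /andP[t0 te].
rewrite -(@pmulr_lle0 _ (t ^+ 2)) ?exprn_gt0 //.
have := H t; rewrite gtr0_norm // => /(_ te); rewrite d0; congr (_ <= 0); ring.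
Qed.

End SmallParameter.

(** * Taylor expansion along a line *)

Section Lines.
Context {R : realFieldType}.
Implicit Types (c : coeffs4 R) (x y u v t : R).

Definition hess_form c x y u v : R :=
  pderiv_eval c 2 0 x y * u ^+ 2 + pderiv_eval c 1 1 x y * u * v *+ 2
  + pderiv_eval c 0 2 x y * v ^+ 2.

Definition line_coef3 c x y u v : R :=
  x * cubic_top (gradx c) u v + y * cubic_top (grady c) u v
  + cf c 3 0 * u ^+ 3 + cf c 2 1 * u ^+ 2 * v + cf c 1 2 * u * v ^+ 2
  + cf c 0 3 * v ^+ 3.

Lemma peval_line c x y u v t :
  peval c (x + t * u) (y + t * v) - peval c x y =
  top4_eval c u v * t ^+ 4 + line_coef3 c x y u v * t ^+ 3
  + hess_form c x y u v / 2 * t ^+ 2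
  + (pderiv_eval c 1 0 x y * u + pderiv_eval c 0 1 x y * v) * t.
Proof.
rewrite /hess_form !pevalE top4_evalE pderiv10E pderiv01E pderiv20E pderiv11E.
rewrite pderiv02E /line_coef3 /cubic_top /gradx /grady.
by field.
Qed.

Lemma pderiv_line c x y u v :
  pderiv_eval c 1 0 (x + u) (y + v) * u + pderiv_eval c 0 1 (x + u) (y + v) * v =
  top4_eval c u v *+ 4 + line_coef3 c x y u v *+ 3 + hess_form c x y u v
  + (pderiv_eval c 1 0 x y * u + pderiv_eval c 0 1 x y * v).
Proof.
rewrite /hess_form top4_evalE !pderiv10E !pderiv01E pderiv20E pderiv11E.
rewrite pderiv02E /line_coef3 /cubic_top /gradx /grady.
by ring.
Qed.

Lemma hess_form_line c x y u v :
  hess_form c (x + u) (y + v) u v =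
  top4_eval c u v *+ 12 + line_coef3 c x y u v *+ 6 + hess_form c x y u v.
Proof.
rewrite /hess_form top4_evalE !pderiv20E !pderiv11E !pderiv02E.
rewrite /line_coef3 /cubic_top /gradx /grady.
by ring.
Qed.

End Lines.

Section LocalMax.
Context {R : rcfType}.
Implicit Types (c : coeffs4 R) (x y u v t : R).

Lemma local_max_line c x y u v : is_local_max c x y ->
  pderiv_eval c 1 0 x y * u + pderiv_eval c 0 1 x y * v = 0
  /\ hess_form c x y u v <= 0.
Proof.
move=> [e e0 H].
pose S := `|u| + `|v| + 1.
have S0 : 0 < S by rewrite /S ltr_wpDl // addr_ge0.
have [||D1 D2] := @quartic_local_max _ (top4_eval c u v) (line_coef3 c x y u v)
  (hess_form c x y u v / 2)
  (pderiv_eval c 1 0 x y * u + pderiv_eval c 0 1 x y * v) (e / S).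
- by rewrite divr_gt0.
- move=> t; rewrite ltr_pdivlMr // => tS; rewrite -peval_line subr_le0; apply: H.
    rewrite addrC addKr normrM; apply: le_lt_trans tS.
    by rewrite ler_wpM2l // /S -addrA lerDl addr_ge0.
  rewrite addrC addKr normrM; apply: le_lt_trans tS.
  by rewrite ler_wpM2l // /S addrAC lerDr addr_ge0.
by split=> //; lra.
Qed.

Lemma local_max_crit c x y : is_local_max c x y -> is_crit c x y.
Proof.
move=> m; have [+ _] := local_max_line _ _ _ 1 0 m.
have [+ _] := local_max_line _ _ _ 0 1 m.
by rewrite !mulr1 !mulr0 add0r addr0 => D1 D2.
Qed.

(** Let [phi] be the restriction to the line, with the two points at [t = 0] and [t = 1], and
    [a > 0] its leading coefficient. As [phi'(0) = 0], one has
    [phi''(1) - 2 phi'(1) = 4 a - phi''(0)]; two maxima make the left side nonpositive and the right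
    side positive. *)
Lemma local_max_unique c x y x' y' : top_pos c ->
  is_local_max c x y -> is_local_max c x' y' -> (x, y) = (x', y').
Proof.
move=> pos m m'; apply/eqP; apply/negPn/negP => neq.
have [E H] := local_max_line _ _ _ (x' - x) (y' - y) m.
have [E' H'] := local_max_line _ _ _ (x' - x) (y' - y) m'.
have a0 : 0 < top4_eval c (x' - x) (y' - y).
  by apply: pos; rewrite xpair_eqE !subr_eq0 -xpair_eqE eq_sym.
have := pderiv_line c x y (x' - x) (y' - y).
have := hess_form_line c x y (x' - x) (y' - y).
rewrite !subrKC E E'.
move: H H' a0.
lra.
Qed.

Lemma global_min_line c x y u v : (forall x' y', peval c x y <= peval c x' y') ->
  pderiv_eval c 1 0 x y * u + pderiv_eval c 0 1 x y * v = 0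
  /\ 0 <= hess_form c x y u v.
Proof.
move=> H.
have [||D1 D2] := @quartic_local_max _ (- top4_eval c u v) (- line_coef3 c x y u v)
  (- (hess_form c x y u v / 2))
  (- (pderiv_eval c 1 0 x y * u + pderiv_eval c 0 1 x y * v)) 1.
- exact: ltr01.
- by move=> t _; rewrite !mulNr -!opprD oppr_le0 -peval_line subr_ge0.
by split; lra.
Qed.

End LocalMax.

(** * Existence of a global minimum *)

Section GlobalMin.
Local Open Scope classical_set_scope.
Local Open Scope ring_scope.
Context {R : realType}.
Variable c : coeffs4 R.
Hypothesis pos : top_pos c.

(** By homogeneity it suffices to minimize over the boundary of the unit square. The form is even,
    so the sides [x = 1] and [y = 1] are enough; [m] is the maximum norm of [(x, y)]. *)
Lemma top4_lower_bound : exists2 d : R, 0 < d &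
  forall x y m, `|x| <= m -> `|y| <= m -> (`|x| == m) || (`|y| == m) ->
  d * m ^+ 4 <= top4_eval c x y.
Proof.
pose F := top4_eval c.
have EVT (f : R -> R) : (exists p : {poly R}, f = horner p) ->
    exists2 t, t \in `[-1, 1] & forall s, s \in `[-1, 1] -> f t <= f s.
  move=> [p ->]; apply: EVT_min; first by rewrite -subr_ge0 opprK addr_ge0.
  by apply: continuous_subspaceT => x; exact: continuous_horner.
have [|t1 _ H1] := EVT (F 1).
  exists (\poly_(i < 5) cf c (4 - i) i); apply/funext => t.
  by rewrite horner_poly /F top4_evalE !big_ord_recl big_ord0 /=; ring.
have [|t2 _ H2] := EVT (F ^~ 1).
  exists (\poly_(i < 5) cf c i (4 - i)); apply/funext => t.
  by rewrite horner_poly /F top4_evalE !big_ord_recl big_ord0 /=; ring.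
have d1 : 0 < F 1 t1 by apply: pos; rewrite xpair_eqE oner_eq0.
have d2 : 0 < F t2 1 by apply: pos; rewrite xpair_eqE oner_eq0 andbF.
exists (Num.min (F 1 t1) (F t2 1)); first by rewrite lt_min d1 d2.
move=> x y m xm ym xym.
have [m0|m0] := eqVneq m 0.
  move: xm ym; rewrite m0 !normr_le0 => /eqP -> /eqP ->.
  by rewrite top4_evalE !expr0n /= !(mulr0, addr0).
have pow4 (z : R) : `|z| = m -> z ^+ 4 = m ^+ 4.
  by move=> <-; rewrite -normrX ger0_norm // exprn_even_ge0.
have m4 : 0 <= m ^+ 4 by rewrite exprn_even_ge0.
have ratio (a b : R) : `|a| = m -> `|b| <= m -> b / a \in `[-1, 1].
  move=> am bm; rewrite in_itv /= -ler_norml normrM normfV am ler_pdivrMr ?mul1r //.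
  by rewrite lt_neqAle eq_sym m0 -am normr_ge0.
case/orP: xym => /eqP zm.
- have x0 : x != 0 by rewrite -normr_eq0 zm.
  have -> : top4_eval c x y = F 1 (y / x) * m ^+ 4.
    by rewrite -(pow4 x) // /F !top4_evalE; field.
  by apply: ler_wpM2r => //; rewrite ge_min H1 // ratio.
have y0 : y != 0 by rewrite -normr_eq0 zm.
have -> : top4_eval c x y = F (x / y) 1 * m ^+ 4.
  by rewrite -(pow4 y) // /F !top4_evalE; field.
by apply: ler_wpM2r => //; rewrite ge_min H2 ?orbT // ratio.
Qed.

Lemma peval_continuous : continuous (fun p : R * R => peval c p.1 p.2).
Proof.
have -> : (fun p : R * R => peval c p.1 p.2) = \sum_(0 <= i < 5) \sum_(0 <= j < 5)
    (fun p : R * R => (if (i + j <= 4)%N then cf c i j else 0) * (p.1 ^+ i * p.2 ^+ j)).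
  apply/funext => p; rewrite /peval pderiv_evalE fct_sumE; apply: eq_bigr => i _.
  rewrite fct_sumE; apply: eq_bigr => j _.
  by case: ifP => _; rewrite ?mul0r // !ffactn0 mulr1 !subn0 mulr1.
have cont_sum (f : nat -> R * R -> R) : (forall i, continuous (f i)) ->
    continuous (\sum_(0 <= i < 5) f i).
  move=> cf; elim/big_ind: _ => //; first exact: cst_continuous.
  by move=> g h cg ch x; apply: continuousD; [exact: cg|exact: ch].
apply: (cont_sum _) => i; apply: (cont_sum _) => j p.
have cX (h : R * R -> R) n : continuous h -> (fun q => h q ^+ n) @ p --> h p ^+ n.
  move=> ch.
  exact: (cvg_comp _ (fun y : R => y ^+ n) (ch p) (@exprn_continuous _ n (h p))).
apply: cvgM; first exact: cvg_cst.
apply: cvgM; apply: cX => q; [exact: cvg_fst|exact: cvg_snd].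
Qed.

Lemma global_min : exists x y, forall x' y', peval c x y <= peval c x' y'.
Proof.
have [d d0 Hd] := top4_lower_bound.
pose C := `|cf c 1 0| + `|cf c 0 1| + `|cf c 2 0| + `|cf c 1 1| + `|cf c 0 2|
  + `|cf c 3 0| + `|cf c 2 1| + `|cf c 1 2| + `|cf c 0 3|.
have C0 : 0 <= C by rewrite /C !addr_ge0.
(* For [m >= r], [m >= 1] bounds the lower terms below by [- C m^3], and [m >= C / d] lets the top
   form, at least [d m^4], compensate. *)
pose r := 1 + C / d.
have r1 : 1 <= r by rewrite lerDl divr_ge0 // ltW.
have outside x y m : r <= m -> `|x| <= m -> `|y| <= m ->
    (`|x| == m) || (`|y| == m) -> peval c 0 0 <= peval c x y.
  move=> rm xm ym xym.
  have m1 : 1 <= m := le_trans r1 rm.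
  have m0 : 0 <= m := le_trans ler01 m1.
  have low (a : R) i j : (i + j <= 3)%N -> - (`|a| * m ^+ 3) <= a * (x ^+ i * y ^+ j).
    move=> ij; rewrite lerNl; apply: le_trans (ler_norm _) _.
    rewrite normrN normrM ler_wpM2l // normrM !normrX.
    apply: (@le_trans _ _ (m ^+ i * m ^+ j)).
      by apply: ler_pM; rewrite ?exprn_ge0 // lerXn2r ?nnegrE.
    by rewrite -exprD ler_weXn2l.
  have := low (cf c 1 0) 1%N 0%N isT; have := low (cf c 0 1) 0%N 1%N isT.
  have := low (cf c 2 0) 2%N 0%N isT; have := low (cf c 1 1) 1%N 1%N isT.
  have := low (cf c 0 2) 0%N 2%N isT; have := low (cf c 3 0) 3%N 0%N isT.
  have := low (cf c 2 1) 2%N 1%N isT; have := low (cf c 1 2) 1%N 2%N isT.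
  have := low (cf c 0 3) 0%N 3%N isT.
  have := Hd x y m xm ym xym; rewrite top4_evalE !pevalE !expr0n /=.
  rewrite !(mulr0, mul0r, addr0, mulr1, mul1r, expr0, expr1).
  have big : C * m ^+ 3 <= d * m ^+ 4.
    have -> : d * m ^+ 4 = d * m * m ^+ 3 by ring.
    rewrite ler_wpM2r ?exprn_ge0 // -ler_pdivrMl //.
    by rewrite mulrC; apply: le_trans rm; rewrite /r lerDr.
  move: big; rewrite /C !mulrDl !mulrA.
  lra.
have [|||p _ Hp] := @compact_EVT_min _ R (fun p : R * R => peval c p.1 p.2)
  (`[- r, r]%classic `*` `[- r, r]%classic)%classic.
- exists (0, 0); split; rewrite /= in_itv /= oppr_le0; apply/andP; split;
    exact: le_trans ler01 r1.
- by apply: compact_setX; exact: segment_compact.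
- by apply: continuous_subspaceT; exact: peval_continuous.
exists p.1, p.2 => x y.
have box x' y' : `|x'| <= r -> `|y'| <= r -> peval c p.1 p.2 <= peval c x' y'.
  move=> xr yr; apply: (Hp (x', y')); rewrite inE; split;
    by rewrite /= in_itv /= -ler_norml.
have r0 : 0 <= r := le_trans ler01 r1.
have [xr|/ltW rx] := leP `|x| r; have [yr|/ltW ry] := leP `|y| r.
- exact: box.
- apply: le_trans (box 0 0 _ _) _; rewrite ?normr0 //.
  by apply: (outside _ _ `|y|); rewrite ?eqxx ?orbT // (le_trans xr).
- apply: le_trans (box 0 0 _ _) _; rewrite ?normr0 //.
  by apply: (outside _ _ `|x|); rewrite ?eqxx ?orbT // (le_trans yr).
apply: le_trans (box 0 0 _ _) _; rewrite ?normr0 //.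
have [xy|/ltW yx] := leP `|x| `|y|.
  by apply: (outside _ _ `|y|); rewrite ?eqxx ?orbT.
by apply: (outside _ _ `|x|); rewrite ?eqxx ?orbT.
Qed.

End GlobalMin.

(** If the only critical point were a local maximum, it would also be the global minimum. Its
    Hessian form would then be both nonpositive and nonnegative, hence zero, against
    nondegeneracy. *)
Lemma morse4_local_max_count (R : realType) (c : coeffs4 R) M m :
  morse4 c -> top_pos c -> num_real_crit c M -> num_local_max c m ->
  (m <= 1)%N /\ (M = 1%N -> m = 0%N).
Proof.
move=> [_ smooth] pos [xs [Uxs [sM Hxs]]] [ys [Uys [sm Hys]]].
have m1 : (m <= 1)%N.
  rewrite -sm; case: ys Uys Hys {sm} => [|[x y] [|[x' y'] ys]] //= Uys Hys.
  have m1 : is_local_max c x y by apply/(Hys (x, y)); rewrite inE eqxx.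
  have m2 : is_local_max c x' y' by apply/(Hys (x', y')); rewrite !inE eqxx orbT.
  move: Uys; rewrite (local_max_unique _ _ _ _ _ pos m1 m2).
  by rewrite inE eqxx.
split=> // M1; case: m m1 sm => [//|[|//]] _ sm.
case: ys sm Hys {Uys} => [//|[x y] [|//]] _ Hys.
have mx : is_local_max c x y by apply/(Hys (x, y)); rewrite inE eqxx.
have [x' [y' mn]] := global_min c pos.
have cx : is_crit c x y := local_max_crit _ _ _ mx.
have cn : is_crit c x' y'.
  have [+ _] := global_min_line _ _ _ 1 0 mn.
  have [+ _] := global_min_line _ _ _ 0 1 mn.
  by rewrite !mulr1 !mulr0 add0r addr0.
case: xs sM Hxs {Uxs} => [|[a b] [|? ?]]; rewrite M1 // => _ Hxs.
have /eqP [ea eb] : (x, y) == (a, b) by rewrite -mem_seq1; apply/Hxs.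
have /eqP [ea' eb'] : (x', y') == (a, b) by rewrite -mem_seq1; apply/Hxs.
rewrite {}ea' {}eb' -{}ea -{}eb in mn.
have hess0 u v : hess_form c x y u v = 0.
  apply/eqP; rewrite eq_le; apply/andP; split.
    by have [] := local_max_line _ _ _ u v mx.
  by have [] := global_min_line _ _ _ u v mn.
have := smooth x%:C y%:C ((is_crit_cplx _ _ _ _).2 cx).
rewrite /hess_det !pderiv_eval_cplx.
have := hess0 1 0; have := hess0 0 1; have := hess0 1 1; rewrite /hess_form.
rewrite !expr0n /= !expr1n !(mulr0, mulr1, addr0, mul0rn, add0r) => h + h20.
rewrite h20 => h02; move: h; rewrite h20 h02 add0r addr0 => /eqP.
by rewrite mulrn_eq0 /= => /eqP ->; rewrite !mulr0 subr0 eqxx.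
Qed.

(** * Realization *)

Section Family.
Variables k2 k1 k0 e4 e2 e1 : int.

(* [y^4 + 2 y^2 k(x) + h(x)] with [k = k2 x^2 + k1 x + k0] and
   [h = e4 x^4 + e2 x^2 + e1 x]. *)
Definition evenq_coef (i j : nat) : int :=
  match i, j with
  | 0, 4 => 1 | 2, 2 => k2 *+ 2 | 1, 2 => k1 *+ 2 | 0, 2 => k0 *+ 2
  | 4, 0 => e4 | 2, 0 => e2 | 1, 0 => e1 | _, _ => 0
  end.

(** Integer coefficients give the same polynomial over [R] and [R[i]], and let conditions at integer
    roots be decided by computation in [int]. *)
Definition evenq (K : comNzRingType) : coeffs4 K :=
  fun i j => (evenq_coef i j)%:~R.

Lemma cf_evenq (K : comNzRingType) i j : (i < 5)%N -> (j < 5)%N ->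
  cf (evenq K) i j = (evenq_coef i j)%:~R.
Proof. by move=> i5 j5; rewrite /cf /evenq !inordK. Qed.

Lemma cplx_evenq (R : rcfType) : cplx (evenq R) = evenq R[i].
Proof.
apply/funext => i; apply/funext => j.
exact: (rmorph_int (real_complex R)).
Qed.

Section Evaluation.
Context {K : comNzRingType}.
Implicit Types z w : K.

Definition evenq_k z : K := k2%:~R * z ^+ 2 + k1%:~R * z + k0%:~R.
Definition evenq_dk z : K := k2%:~R * z *+ 2 + k1%:~R.
Definition evenq_dh z : K := e4%:~R * z ^+ 3 *+ 4 + e2%:~R * z *+ 2 + e1%:~R.
Definition evenq_ddh z : K := e4%:~R * z ^+ 2 *+ 12 + e2%:~R *+ 2.
(* The critical points off the axis [y = 0] lie on [y^2 = - k(x)], where the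
   polynomial is [g = h - k^2]. *)
Definition evenq_dg z : K := evenq_dh z - evenq_k z * evenq_dk z *+ 2.
Definition evenq_ddg z : K :=
  evenq_ddh z - (evenq_dk z ^+ 2 + evenq_k z * k2%:~R *+ 2) *+ 2.

Let cfE := (@cf_evenq K, rmorphMn, rmorph0, rmorph1).

Lemma evenq_top z w : top4_eval (evenq K) z w =
  w ^+ 4 + k2%:~R * z ^+ 2 * w ^+ 2 *+ 2 + e4%:~R * z ^+ 4.
Proof. by rewrite top4_evalE !cfE //=; ring. Qed.

Lemma evenq_eval z w : peval (evenq K) z w =
  w ^+ 4 + evenq_k z * w ^+ 2 *+ 2
  + (e4%:~R * z ^+ 4 + e2%:~R * z ^+ 2 + e1%:~R * z).
Proof. by rewrite pevalE !cfE //= /evenq_k; ring. Qed.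

Lemma evenq_dx z w :
  pderiv_eval (evenq K) 1 0 z w = w ^+ 2 * evenq_dk z *+ 2 + evenq_dh z.
Proof. by rewrite pderiv10E !cfE //= /evenq_dk /evenq_dh; ring. Qed.

Lemma evenq_dy z w :
  pderiv_eval (evenq K) 0 1 z w = w * (w ^+ 2 + evenq_k z) *+ 4.
Proof. by rewrite pderiv01E !cfE //= /evenq_k; ring. Qed.

Lemma evenq_dxx z w : pderiv_eval (evenq K) 2 0 z w =
  w ^+ 2 * k2%:~R *+ 4 + evenq_ddh z.
Proof. by rewrite pderiv20E !cfE //= /evenq_ddh; ring. Qed.

Lemma evenq_dxy z w : pderiv_eval (evenq K) 1 1 z w = w * evenq_dk z *+ 4.
Proof. by rewrite pderiv11E !cfE //= /evenq_dk; ring. Qed.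

Lemma evenq_dyy z w :
  pderiv_eval (evenq K) 0 2 z w = w ^+ 2 *+ 12 + evenq_k z *+ 4.
Proof. by rewrite pderiv02E !cfE //= /evenq_k; ring. Qed.

End Evaluation.

Lemma evenq_crit (K : numFieldType) (z w : K) : is_crit (evenq K) z w <->
  (w = 0 /\ evenq_dh z = 0) \/ (w ^+ 2 = - evenq_k z /\ evenq_dg z = 0).
Proof.
rewrite /is_crit evenq_dx evenq_dy; split.
  move=> [Hx /eqP]; rewrite mulrn_eq0 /= mulf_eq0 => /orP[/eqP w0|/eqP Hy].
    by left; split=> //; rewrite -[RHS]Hx w0 expr0n mul0r mul0rn add0r.
  have w2 : w ^+ 2 = - evenq_k z by apply/eqP; rewrite -addr_eq0 Hy.
  by right; split=> //; rewrite -[RHS]Hx w2 /evenq_dg; ring.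
case=> [[-> ->]|[w2 Hg]]; first by rewrite expr0n !mul0r !mul0rn addr0.
split; last by rewrite w2 addNr mulr0 mul0rn.
by rewrite w2 -[RHS]Hg /evenq_dg; ring.
Qed.

Hypothesis top_form_pos : k2 ^+ 2 < e4.
Hypothesis dh_simple : forall (K : numFieldType) (z : K),
  evenq_dh z = 0 -> evenq_ddh z != 0 /\ evenq_k z != 0.
Hypothesis dg_simple : forall (K : numFieldType) (z : K),
  evenq_dg z = 0 -> evenq_ddg z != 0.

(** The Hessian determinant is [4 k h''] on the axis and [- 8 k g''] where [y^2 = - k]. In the
    second case [k = 0] would give [h' = g' = 0], which [dh_simple] excludes. *)
Lemma evenq_hess (K : numFieldType) (z w : K) :
  is_crit (evenq K) z w -> hess_det (evenq K) z w != 0.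
Proof.
rewrite /hess_det evenq_dxx evenq_dxy evenq_dyy.
move=> /evenq_crit [[-> H]|[w2 H]].
  have [ddh k] := dh_simple _ _ H.
  rewrite expr0n !(mul0r, mul0rn, add0r) subr0 mulf_neq0 //.
  by rewrite mulrn_eq0.
have k : evenq_k z != 0.
  apply/eqP => k0'; have := H; rewrite /evenq_dg k0' mul0r mul0rn subr0.
  by move/dh_simple => [_]; rewrite k0' eqxx.
have -> : (w ^+ 2 * k2%:~R *+ 4 + evenq_ddh z) * (w ^+ 2 *+ 12 + evenq_k z *+ 4)
   - w * evenq_dk z *+ 4 * (w * evenq_dk z *+ 4) =
   (w ^+ 2 * k2%:~R *+ 4 + evenq_ddh z) * (w ^+ 2 *+ 12 + evenq_k z *+ 4)
   - w ^+ 2 * evenq_dk z ^+ 2 *+ 16 by ring.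
rewrite w2.
have -> : (- evenq_k z * k2%:~R *+ 4 + evenq_ddh z) *
   (- evenq_k z *+ 12 + evenq_k z *+ 4)
   - - evenq_k z * evenq_dk z ^+ 2 *+ 16 = - (evenq_k z * evenq_ddg z) *+ 8.
  by rewrite /evenq_ddg; ring.
by rewrite mulrn_eq0 /= oppr_eq0 mulf_neq0 // dg_simple.
Qed.

Lemma evenq_top_pos (R : rcfType) : top_pos (evenq R).
Proof.
move=> x y xy; rewrite evenq_top.
have -> : y ^+ 4 + k2%:~R * x ^+ 2 * y ^+ 2 *+ 2 + e4%:~R * x ^+ 4 =
  (y ^+ 2 + k2%:~R * x ^+ 2) ^+ 2 + (e4 - k2 ^+ 2)%:~R * x ^+ 4 :> R.
  by rewrite rmorphB rmorphXn /=; ring.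
have e0 : 0 < (e4 - k2 ^+ 2)%:~R :> R by rewrite ltr0z subr_gt0.
have [x0|x0] := eqVneq x 0.
  move: xy; rewrite x0 xpair_eqE eqxx /= => y0.
  by rewrite !expr0n !mulr0 !addr0 exprn_even_gt0 //= sqrf_eq0.
by rewrite ltr_wpDl ?sqr_ge0 // mulr_gt0 // exprn_even_gt0.
Qed.

(** The form is quadratic in [w^2] and equals [(w^2 - a^2 z^2) (w^2 - b^2 z^2)]. Here [a^2 != b^2]
    because [k2^2 != e4], and [a b != 0] because [a^2 b^2 = e4 > 0], so the slopes [a], [- a], [b],
    [- b] are distinct. *)
Lemma evenq_nondeg_top (R : rcfType) : nondeg_top (evenq R).
Proof.
pose C : numClosedFieldType := R[i].
pose d : C := sqrtC (k2 ^+ 2 - e4)%:~R.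
have d2 : d ^+ 2 = (k2 ^+ 2 - e4)%:~R by rewrite sqrtCK.
have dn0 : d != 0.
  by rewrite -sqrf_eq0 d2 intr_eq0 subr_eq0 lt_eqF.
pose a : C := sqrtC (- k2%:~R + d).
pose b : C := sqrtC (- k2%:~R - d).
have a2 : a ^+ 2 = - k2%:~R + d by rewrite sqrtCK.
have b2 : b ^+ 2 = - k2%:~R - d by rewrite sqrtCK.
have ab : a ^+ 2 - b ^+ 2 != 0.
  rewrite a2 b2; have -> : - k2%:~R + d - (- k2%:~R - d) = d *+ 2 by ring.
  by rewrite mulrn_eq0.
have abn0 : a * b != 0.
  rewrite -sqrf_eq0 exprMn a2 b2.
  have -> : (- k2%:~R + d) * (- k2%:~R - d) = k2%:~R ^+ 2 - d ^+ 2 by ring.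
  rewrite d2 -rmorphXn -rmorphB intr_eq0 /= opprB addrC subrK.
  by rewrite gt_eqF // (le_lt_trans _ top_form_pos) // sqr_ge0.
have a0 : a != 0 by apply: contraNneq abn0 => ->; rewrite mul0r.
have b0 : b != 0 by apply: contraNneq abn0 => ->; rewrite mulr0.
have amb : a - b != 0.
  by apply: contraNneq ab => H; rewrite subr_sqr H mul0r.
have apb : a + b != 0.
  by apply: contraNneq ab => H; rewrite subr_sqr H mulr0.
pose s := [:: a; - a; b; - b].
exists (fun k : 'I_4 => s`_k), (fun=> 1); split.
  move=> z w; rewrite cplx_evenq evenq_top !big_ord_recl big_ord0 /=.
  have -> : e4%:~R = (- k2%:~R + d) * (- k2%:~R - d) :> C.
    have -> : (- k2%:~R + d) * (- k2%:~R - d) = k2%:~R ^+ 2 - d ^+ 2 by ring.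
    by rewrite d2 rmorphB rmorphXn /=; ring.
  rewrite -a2 -b2.
  have -> : k2%:~R * z ^+ 2 * w ^+ 2 *+ 2 = - (a ^+ 2 + b ^+ 2) * z ^+ 2 * w ^+ 2 :> C.
    by rewrite a2 b2; ring.
  by ring.
move=> k l; rewrite mulr1 mul1r.
have opp_neq (c : C) : c != 0 -> c != - c.
  by move=> c0; rewrite -subr_eq0 opprK -mulr2n mulrn_eq0.
have Us : uniq s.
  rewrite /s /= !inE !negb_or eqr_opp (eqr_oppLR a b) !opp_neq // !andbT.
  by rewrite -![a == _]subr_eq0 opprK amb apb.
by move=> kl; rewrite subr_eq0 nth_uniq.
Qed.

End Family.

Lemma neg_near (R : realFieldType) (a b c d : R) : a < 0 ->
  exists2 e : R, 0 < e & forall t y, `|t| < e -> `|y| < e ->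
    a + b * t + c * t ^+ 2 + d * y ^+ 2 <= 0.
Proof.
move=> a0; pose S := `|b| + `|c| + `|d| + 1.
have S0 : 0 < S by rewrite /S ltr_wpDl // !addr_ge0.
(* For arguments below 1 squares are at most absolute values, so the perturbation is at most [S m]
   with [m] the larger of [|t|] and [|y|]. *)
exists (Num.min 1 (- a / S)); first by rewrite lt_min ltr01 divr_gt0 ?oppr_gt0.
move=> t y; rewrite !lt_min => /andP[t1 ta] /andP[y1 ya].
have sq (z : R) : `|z| < 1 -> z ^+ 2 <= `|z|.
  by move=> z1; rewrite -real_normK ?num_real // expr2 ler_piMl // ltW.
pose m := Num.max `|t| `|y|.
have mS : m * S < - a by rewrite -ltr_pdivlMr // gt_max ta ya.
have tm : `|t| <= m by rewrite le_max lexx.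
have ym : `|y| <= m by rewrite le_max lexx orbT.
have bnd (x z : R) : `|z| <= m -> x * z <= `|x| * m.
  move=> zm; apply: le_trans (ler_norm _) _.
  by rewrite normrM ler_wpM2l.
have t2 : `|t ^+ 2| <= m.
  by rewrite ger0_norm ?sqr_ge0 // (le_trans (sq t t1)).
have y2 : `|y ^+ 2| <= m.
  by rewrite ger0_norm ?sqr_ge0 // (le_trans (sq y y1)).
have := bnd b t tm; have := bnd c _ t2; have := bnd d _ y2.
have m0 : 0 <= m by apply: le_trans tm.
move: mS; rewrite /S !mulrDr mulr1 ![m * _]mulrC; lra.
Qed.

(** * Counting critical points and local maxima in the family *)

Section FamilyCount.
Variables (k2 k1 k0 e4 e2 e1 : int).
Local Notation fk := (evenq_k k2 k1 k0).
Local Notation dh := (evenq_dh e4 e2 e1).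
Local Notation ddh := (evenq_ddh e4 e2).
Local Notation dg := (evenq_dg k2 k1 k0 e4 e2 e1).
Local Notation ddg := (evenq_ddg k2 k1 k0 e4 e2).
Local Notation fam := (evenq k2 k1 k0 e4 e2 e1).

Hypothesis top_form_pos : k2 ^+ 2 < e4.
Hypothesis dh_simple : forall (K : numFieldType) (z : K),
  dh z = 0 -> ddh z != 0 /\ fk z != 0.
Hypothesis dg_simple : forall (K : numFieldType) (z : K), dg z = 0 -> ddg z != 0.

Lemma dg_k_neq0 (K : numFieldType) (z : K) : dg z = 0 -> fk z != 0.
Proof.
move=> Hg; apply/eqP => kz; have : dh z = 0.
  by rewrite -[RHS]Hg /evenq_dg kz mul0r mul0rn subr0.
by move/dh_simple => [_]; rewrite kz eqxx.
Qed.

(** Off the axis [y^2 = - k] forces [k <= 0], while the second derivative in [y] is [- 8 k], so a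
    maximum would have [k = 0]. On the axis the Hessian is diagonal, with entries [h''] and
    [4 k]. *)
Lemma evenq_local_max (R : rcfType) (x y : R) : is_local_max (fam R) x y <->
  [/\ y = 0, dh x = 0, ddh x < 0 & fk x < 0].
Proof.
split=> [mx|[-> dhx ddhx kx]].
  have [_] := local_max_line _ _ _ 1 0 mx; have [_] := local_max_line _ _ _ 0 1 mx.
  rewrite /hess_form evenq_dxx evenq_dyy !expr0n !expr1n /=.
  rewrite !(mulr0, mulr1, mul0rn, addr0, add0r) => Hy Hx.
  have /evenq_crit [[y0 dhx]|[y2 dgx]] := local_max_crit _ _ _ mx.
    have [ddh0 k0'] := dh_simple _ _ dhx.
    move: Hx Hy; rewrite y0 expr0n /= !(mul0r, mul0rn, add0r) => Hx Hy.
    by split=> //; rewrite lt_neqAle ?ddh0 ?k0' //= -(pmulrn_lle0 _ (isT : (0 < 4)%N)).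
  have kn := dg_k_neq0 _ _ dgx.
  have : 0 <= y ^+ 2 by exact: sqr_ge0.
  rewrite y2 oppr_ge0 => kle; move: Hy; rewrite y2 => Hy.
  by exfalso; move/eqP: kn; apply; lra.
have [ex ex0 Hx] := @neg_near R (ddh x / 2) (e4%:~R * x *+ 4) e4%:~R 0 (ltac:(lra)).
have [ey ey0 Hy] := @neg_near R (fk x *+ 2) (evenq_dk k2 k1 x *+ 2)
  (k2%:~R *+ 2) 1 (ltac:(lra)).
exists (Num.min ex ey); first by rewrite lt_min ex0 ey0.
move=> x' y'; rewrite subr0 !lt_min => /andP[xx xy] /andP[yx yy].
have Hk := Hx _ _ xx yx; have Hh := Hy _ _ xy yy.
rewrite -subr_le0 !evenq_eval.
(* The increment is [y'^2] times one factor plus [(x' - x)^2] times another, both nonpositive near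
   the point by [neg_near], plus a linear term killed by [h'(x) = 0]. *)
have -> : y' ^+ 4 + fk x' * y' ^+ 2 *+ 2 +
    (e4%:~R * x' ^+ 4 + e2%:~R * x' ^+ 2 + e1%:~R * x') -
    (0 ^+ 4 + fk x * 0 ^+ 2 *+ 2 + (e4%:~R * x ^+ 4 + e2%:~R * x ^+ 2 + e1%:~R * x)) =
    y' ^+ 2 * (fk x *+ 2 + evenq_dk k2 k1 x *+ 2 * (x' - x)
      + k2%:~R *+ 2 * (x' - x) ^+ 2 + 1 * y' ^+ 2)
    + (x' - x) ^+ 2 * (ddh x / 2 + e4%:~R * x *+ 4 * (x' - x) + e4%:~R * (x' - x) ^+ 2
      + 0 * y' ^+ 2) + dh x * (x' - x).
  by rewrite /evenq_k /evenq_dk /evenq_ddh /evenq_dh; field.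
rewrite dhx (mul0r (x' - x)) addr0.
by rewrite -oppr_ge0 opprD; apply: addr_ge0; rewrite oppr_ge0 mulr_ge0_le0 ?sqr_ge0.
Qed.

(** Each root of [g'] with [k < 0] carries the two points [y = sqrt (- k)] and [y = - sqrt (- k)]; a
    root with [k > 0] carries no real point. *)
Lemma evenq_realizes (R : realType) (A B X : seq R) :
  uniq A -> (forall x, x \in A <-> dh x = 0) ->
  uniq B -> (forall x, x \in B <-> dg x = 0 /\ fk x < 0) ->
  uniq X -> (forall x, x \in X <-> [/\ dh x = 0, ddh x < 0 & fk x < 0]) ->
  exists c : coeffs4 R, [/\ morse4 c, top_pos c,
    num_real_crit c (size A + (size B).*2) & num_local_max c (size X)].
Proof.
move=> UA HA UB HB UX HX; exists (fam R); split.
- split; first exact: evenq_nondeg_top.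
  by move=> z w; rewrite cplx_evenq; exact: evenq_hess.
- exact: evenq_top_pos.
- pose s (x : R) := Num.sqrt (- fk x).
  have s0 x : x \in B -> 0 < s x.
    by move=> /HB [_ kx]; rewrite sqrtr_gt0 oppr_gt0.
  exists ([seq (x, 0) | x <- A] ++
    ([seq (x, s x) | x <- B] ++ [seq (x, - s x) | x <- B])); split.
    rewrite !cat_uniq !map_inj_in_uniq ?UA ?UB //; try by [move=> ? ? _ _ []].
    rewrite !andbT /=; apply/andP; split; apply/hasPn => -[x y].
      rewrite mem_cat => yB; apply/negP => /mapP [x' _ [_ y0]].
      case/orP: yB => /mapP [x2 /s0 s2 [_ ys]]; move: s2.
        by rewrite -ys y0 ltxx.
      by rewrite -oppr_lt0 -ys y0 ltxx.
    move=> /mapP [x1 /s0 + [-> ->]]; move=> s1; apply/negP => /mapP [x2 /s0 s2 [_ E]].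
    by move: s1; rewrite -oppr_lt0 E ltNge ltW.
  split; first by rewrite !size_cat !size_map addnn.
  move=> [x y] /=; rewrite !mem_cat; split.
    case/or3P=> /mapP [x' + [-> ->]].
    - by move/HA => H; apply/evenq_crit; left.
    - move=> xB; have [H kx] := (HB x').1 xB; apply/evenq_crit; right.
      by rewrite sqr_sqrtr // oppr_ge0 ltW.
    - move=> xB; have [H kx] := (HB x').1 xB; apply/evenq_crit; right.
      by rewrite sqrrN sqr_sqrtr // oppr_ge0 ltW.
  case/evenq_crit=> [[-> /HA H]|[y2 H]]; first by rewrite map_f.
  have kx : fk x < 0.
    rewrite lt_neqAle dg_k_neq0 //= -oppr_ge0 -y2; exact: sqr_ge0.
  have xB : x \in B by apply/HB.
  have : (y == s x) || (y == - s x).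
    by rewrite -eqf_sqr sqr_sqrtr ?y2 // oppr_ge0 ltW.
  by case/orP=> /eqP ->; apply/or3P; [apply: Or32|apply: Or33];
    apply/mapP; exists x.
exists [seq (x, 0) | x <- X]; split.
  by rewrite map_inj_uniq // => ? ? [].
split; first by rewrite size_map.
move=> [x y] /=; rewrite evenq_local_max; split.
  by move=> /mapP [x' /HX [? ? ?] [-> ->]].
by move=> [-> ? ? ?]; apply: map_f; apply/HX.
Qed.

End FamilyCount.

Local Notation ints s := [seq r%:~R | r <- s].

Lemma split_cubic_roots (K : numFieldType) (f : K -> K) (a r1 r2 r3 : int) :
  a != 0 -> (forall z, f z =
    a%:~R * ((z - r1%:~R) * (z - r2%:~R) * (z - r3%:~R))) ->
  forall z, f z = 0 <-> z \in ints [:: r1; r2; r3].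
Proof.
move=> a0 E z; rewrite E /= !inE -!(subr_eq0 z); split.
  by move/eqP; rewrite !mulf_eq0 intr_eq0 (negPf a0) -orbA.
by case/or3P => /eqP ->; rewrite ?(mul0r, mulr0).
Qed.

Lemma cubic_one_root (K : numFieldType) (f : K -> K) (r a b c : int) :
  (forall z, f z = (z - r%:~R) * (a%:~R * z ^+ 2 + b%:~R * z + c%:~R)) ->
  forall z, f z = 0 ->
    z \in ints [:: r] \/ a%:~R * z ^+ 2 + b%:~R * z + c%:~R = 0.
Proof.
move=> E z; rewrite E => /eqP; rewrite mulf_eq0 subr_eq0 inE.
by case/orP => [|/eqP]; [left|right].
Qed.

Lemma cubic_one_real_root (R : realFieldType) (f : R -> R) (r a b c : int) :
  (forall z, f z = (z - r%:~R) * (a%:~R * z ^+ 2 + b%:~R * z + c%:~R)) ->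
  b ^+ 2 < a * c *+ 4 ->
  forall z, f z = 0 <-> z \in ints [:: r].
Proof.
move=> E disc z; split; last first.
  by rewrite inE => /eqP ->; rewrite E subrr mul0r.
case/(@cubic_one_root _ f r a b c E) => // q0; exfalso.
have : (b%:~R ^+ 2 < a%:~R * c%:~R *+ 4 :> R).
  by rewrite -rmorphXn -rmorphM -rmorphMn /= ltr_int.
rewrite -subr_gt0 ltNge => /negP; apply.
have -> : a%:~R * c%:~R *+ 4 - b%:~R ^+ 2 =
  a%:~R * (a%:~R * z ^+ 2 + b%:~R * z + c%:~R) *+ 4
  - (a%:~R * z *+ 2 + b%:~R) ^+ 2 :> R by ring.
by rewrite q0 mulr0 mul0rn sub0r oppr_le0 sqr_ge0.
Qed.

(** Serves at the nonreal roots of a quadratic factor [q]: a nonzero integer in the ideal of [q] and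
    [p] certifies that they have no common root. *)
Lemma bezout_neq0 (K : numFieldType) (q p u v : K) (n : int) :
  n != 0 -> q = 0 -> n%:~R = u * q + v * p -> p != 0.
Proof.
move=> n0 -> E; apply: contraNneq n0 => p0.
by rewrite -(@intr_eq0 K) E p0 !mulr0 addr0.
Qed.

Section IntegerRoots.
Variables k2 k1 k0 e4 e2 e1 : int.
Local Notation fk := (evenq_k k2 k1 k0).
Local Notation dh := (evenq_dh e4 e2 e1).
Local Notation ddh := (evenq_ddh e4 e2).
Local Notation dg := (evenq_dg k2 k1 k0 e4 e2 e1).
Local Notation ddg := (evenq_ddg k2 k1 k0 e4 e2).

Lemma evenq_int (K : comNzRingType) (r : int) :
  [/\ fk (r%:~R : K) = (fk r)%:~R, ddh (r%:~R : K) = (ddh r)%:~R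
    & ddg (r%:~R : K) = (ddg r)%:~R].
Proof.
rewrite /evenq_ddg /evenq_ddh /evenq_dk /evenq_k.
by split; rewrite !(rmorphB, rmorphD, rmorphM, rmorphMn, rmorphXn, rmorph_int).
Qed.

Lemma dh_simple_at_ints (K : numFieldType) (s : seq int) (z : K) :
  all (fun r => (ddh r != 0) && (fk r != 0)) s -> z \in ints s ->
  ddh z != 0 /\ fk z != 0.
Proof.
move=> /allP H /mapP [r /H /andP[h k] ->].
by have [-> -> _] := evenq_int K r; rewrite !intr_eq0.
Qed.

Lemma dg_simple_at_ints (K : numFieldType) (s : seq int) (z : K) :
  all (fun r => ddg r != 0) s -> z \in ints s -> ddg z != 0.
Proof.
move=> /allP H /mapP [r /H g ->].
by have [_ _ ->] := evenq_int K r; rewrite intr_eq0.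
Qed.

(** When the real roots of [h'] and [g'] are integers, both numbers become counts of signs over
    [int], found by evaluation. *)
Lemma evenq_realizes_int (R : realType) (A G : seq int) :
  k2 ^+ 2 < e4 ->
  (forall (K : numFieldType) (z : K), dh z = 0 -> ddh z != 0 /\ fk z != 0) ->
  (forall (K : numFieldType) (z : K), dg z = 0 -> ddg z != 0) ->
  uniq A -> (forall x : R, dh x = 0 <-> x \in ints A) ->
  uniq G -> (forall x : R, dg x = 0 <-> x \in ints G) ->
  exists c : coeffs4 R, [/\ morse4 c, top_pos c,
    num_real_crit c (size A + (count (fun r => fk r < 0) G).*2)
    & num_local_max c (count (fun r => (ddh r < 0) && (fk r < 0)) A)].
Proof.
move=> top dh_s dg_s UA HA UG HG.
have Uints (s : seq int) : uniq s -> uniq (ints s : seq R).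
  by rewrite map_inj_uniq //; exact: intr_inj.
have countE (P : pred R) (Q : pred int) s : (forall r : int, P r%:~R = Q r) ->
    count Q s = size [seq x <- ints s | P x].
  move=> PQ; rewrite size_filter count_map; apply: eq_count => r /=.
  by rewrite PQ.
rewrite -(size_map (fun r : int => r%:~R : R) A).
rewrite (countE (fun x => fk x < 0)); last first.
  by move=> r; have [-> _ _] := evenq_int R r; rewrite ltrz0.
rewrite (countE (fun x => (ddh x < 0) && (fk x < 0))); last first.
  by move=> r; have [-> -> _] := evenq_int R r; rewrite !ltrz0.
apply: (evenq_realizes _ _ _ _ _ e1 top dh_s dg_s); rewrite ?filter_uniq ?Uints //.
- by move=> x; rewrite HA.
- by move=> x; rewrite mem_filter HG; split=> [/andP[-> ->]|[-> ->]].
move=> x; rewrite mem_filter.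
by split=> [/andP[/andP[-> ->] /HA ->]|[/HA -> -> ->]].
Qed.

End IntegerRoots.

Ltac evenq_ring :=
  rewrite /evenq_ddg /evenq_dg /evenq_ddh /evenq_dh /evenq_dk /evenq_k; ring.

Definition realizable (R : realType) (M m : nat) :=
  exists c : coeffs4 R,
    [/\ morse4 c, top_pos c, num_real_crit c M & num_local_max c m].

(** * One polynomial for each of the nine pairs *)

Section Examples.
Variable R : realType.

Lemma realizable_1_0 : realizable R 1 0.
Proof.
have dhE (K : numFieldType) (z : K) : evenq_dh 1 2 0 z =
    (z - 0%:~R) * (4%:~R * z ^+ 2 + 0%:~R * z + 4%:~R).
  by evenq_ring.
have dgE (K : numFieldType) (z : K) : evenq_dg 0 0 1 1 2 0 z =
    (z - 0%:~R) * (4%:~R * z ^+ 2 + 0%:~R * z + 4%:~R).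
  by evenq_ring.
(* [k = 1] leaves no real point off the axis, and [h] is convex. *)
apply: (@evenq_realizes_int 0 0 1 1 2 0 R
  [:: 0] [:: 0]) => //.
- move=> K z /(cubic_one_root _ _ _ _ _ _ (dhE K)) [|q0].
    by apply: dh_simple_at_ints.
  by split; [apply: (bezout_neq0 _ _ _ (-3) 1 (-8) _ q0)
    |apply: (bezout_neq0 _ _ _ 0 1 1 _ q0)];
    rewrite //; evenq_ring.
- move=> K z /(cubic_one_root _ _ _ _ _ _ (dgE K)) [|q0].
    by apply: dg_simple_at_ints.
  by apply: (bezout_neq0 _ _ _ (-3) 1 (-8) _ q0);
    rewrite //; evenq_ring.
- exact: (cubic_one_real_root _ _ _ _ _ _ (dhE R)).
- exact: (cubic_one_real_root _ _ _ _ _ _ (dgE R)).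
Qed.

Lemma realizable_3_0 : realizable R 3 0.
Proof.
have dhE (K : numFieldType) := @split_cubic_roots K
  (evenq_dh 1 (-2) 0) 4 0 1 (-1) isT
  (ltac:(move=> z; evenq_ring)).
have dgE (K : numFieldType) := @split_cubic_roots K
  (evenq_dg 0 0 1 1 (-2) 0) 4 0 1 (-1) isT
  (ltac:(move=> z; evenq_ring)).
apply: (@evenq_realizes_int 0 0 1 1 (-2) 0 R
  [:: 0; 1; -1] [:: 0; 1; -1]) => //.
- by move=> K z /dhE; apply: dh_simple_at_ints.
- by move=> K z /dgE; apply: dg_simple_at_ints.
- exact: dhE.
- exact: dgE.
Qed.

Lemma realizable_5_0 : realizable R 5 0.
Proof.
have dhE (K : numFieldType) (z : K) : evenq_dh 1 2 0 z =
    (z - 0%:~R) * (4%:~R * z ^+ 2 + 0%:~R * z + 4%:~R).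
  by evenq_ring.
have dgE (K : numFieldType) := @split_cubic_roots K
  (evenq_dg 0 4 3 1 2 0) 4 (-2) (-1) 3 isT
  (ltac:(move=> z; evenq_ring)).
(* [k = 4 x + 3] is positive at 0 and, among the roots of [g'], negative at -2 and -1 only: 1 + 4
   points. *)
apply: (@evenq_realizes_int 0 4 3 1 2 0 R
  [:: 0] [:: -2; -1; 3]) => //.
- move=> K z /(cubic_one_root _ _ _ _ _ _ (dhE K)) [|q0].
    by apply: dh_simple_at_ints.
  by split; [apply: (bezout_neq0 _ _ _ (-3) 1 (-8) _ q0)
    |apply: (bezout_neq0 _ _ _ (-4) (4 * z - 3) (-25) _ q0)];
    rewrite //; evenq_ring.
- by move=> K z /dgE; apply: dg_simple_at_ints.
- exact: (cubic_one_real_root _ _ _ _ _ _ (dhE R)).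
- exact: dgE.
Qed.

Lemma realizable_7_0 : realizable R 7 0.
Proof.
have dhE (K : numFieldType) := @split_cubic_roots K
  (evenq_dh 1 (-2) 0) 4 0 1 (-1) isT
  (ltac:(move=> z; evenq_ring)).
have dgE (K : numFieldType) := @split_cubic_roots K
  (evenq_dg 0 6 10 1 (-2) 0) 4 (-2) (-3) 5 isT
  (ltac:(move=> z; evenq_ring)).
(* [k = 6 x + 10] is positive at the roots of [h'] and negative at the roots -2 and -3 of [g']: 3 +
   4 points. *)
apply: (@evenq_realizes_int 0 6 10 1 (-2) 0 R
  [:: 0; 1; -1] [:: -2; -3; 5]) => //.
- by move=> K z /dhE; apply: dh_simple_at_ints.
- by move=> K z /dgE; apply: dg_simple_at_ints.
- exact: dhE.
- exact: dgE.
Qed.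

Lemma realizable_9_0 : realizable R 9 0.
Proof.
have dhE (K : numFieldType) := @split_cubic_roots K
  (evenq_dh 182 (-2548) (-4368)) 728 (-2) (-1) 3 isT
  (ltac:(move=> z; evenq_ring)).
have dgE (K : numFieldType) := @split_cubic_roots K
  (evenq_dg (-13) 0 61 182 (-2548) (-4368)) 52 (-3) (-4) 7 isT
  (ltac:(move=> z; evenq_ring)).
(* The concave [k = 61 - 13 x^2] is negative at all roots of [g'] but positive at -1, the local
   maximum of [h]: 3 + 6 points, none a maximum. *)
apply: (@evenq_realizes_int (-13) 0 61 182 (-2548) (-4368) R
  [:: -2; -1; 3] [:: -3; -4; 7]) => //.
- by move=> K z /dhE; apply: dh_simple_at_ints.
- by move=> K z /dgE; apply: dg_simple_at_ints.
- exact: dhE.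
- exact: dgE.
Qed.

Lemma realizable_3_1 : realizable R 3 1.
Proof.
have dhE (K : numFieldType) := @split_cubic_roots K
  (evenq_dh 12 (-168) 288) 48 (-3) 1 2 isT
  (ltac:(move=> z; evenq_ring)).
have dgE (K : numFieldType) (z : K) : evenq_dg 3 0 (-18) 12 (-168) 288 z =
    (z - (-4)%:~R) * (12%:~R * z ^+ 2 + (-48)%:~R * z + 72%:~R).
  by evenq_ring.
(* [k = 3 x^2 - 18] is negative at 1, the local maximum of [h], and positive at -4, the only real
   root of [g']. *)
apply: (@evenq_realizes_int 3 0 (-18) 12 (-168) 288 R
  [:: -3; 1; 2] [:: -4]) => //.
- by move=> K z /dhE; apply: dh_simple_at_ints.
- move=> K z /(cubic_one_root _ _ _ _ _ _ (dgE K)) [|q0].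
    by apply: dg_simple_at_ints.
  by apply: (bezout_neq0 _ _ _ (9 * z + 21) (5 - 3 * z) 912 _ q0);
    rewrite //; evenq_ring.
- exact: dhE.
- exact: (cubic_one_real_root _ _ _ _ _ _ (dgE R)).
Qed.

Lemma realizable_5_1 : realizable R 5 1.
Proof.
have dhE (K : numFieldType) := @split_cubic_roots K
  (evenq_dh 3 (-6) 0) 12 0 1 (-1) isT
  (ltac:(move=> z; evenq_ring)).
have dgE (K : numFieldType) (z : K) : evenq_dg 0 3 (-6) 3 (-6) 0 z =
    (z - (-2)%:~R) * (12%:~R * z ^+ 2 + (-24)%:~R * z + 18%:~R).
  by evenq_ring.
(* [k = 3 x - 6] is negative at 0, the local maximum of [h], and at -2, the only real root of [g']:
   3 + 2 points. *)
apply: (@evenq_realizes_int 0 3 (-6) 3 (-6) 0 R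
  [:: 0; 1; -1] [:: -2]) => //.
- by move=> K z /dhE; apply: dh_simple_at_ints.
- move=> K z /(cubic_one_root _ _ _ _ _ _ (dgE K)) [|q0].
    by apply: dg_simple_at_ints.
  by apply: (bezout_neq0 _ _ _ (18 * z + 21) (5 - 6 * z) 228 _ q0);
    rewrite //; evenq_ring.
- exact: dhE.
- exact: (cubic_one_real_root _ _ _ _ _ _ (dgE R)).
Qed.

Lemma realizable_7_1 : realizable R 7 1.
Proof.
have dhE (K : numFieldType) := @split_cubic_roots K
  (evenq_dh 2 (-16) 0) 8 0 2 (-2) isT
  (ltac:(move=> z; evenq_ring)).
have dgE (K : numFieldType) := @split_cubic_roots K
  (evenq_dg 0 6 (-8) 2 (-16) 0) 8 1 3 (-4) isT
  (ltac:(move=> z; evenq_ring)).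
(* [k = 6 x - 8] is negative at 0, the local maximum of [h], and at the roots 1 and -4 of [g']: 3 +
   4 points. *)
apply: (@evenq_realizes_int 0 6 (-8) 2 (-16) 0 R
  [:: 0; 2; -2] [:: 1; 3; -4]) => //.
- by move=> K z /dhE; apply: dh_simple_at_ints.
- by move=> K z /dgE; apply: dg_simple_at_ints.
- exact: dhE.
- exact: dgE.
Qed.

Lemma realizable_9_1 : realizable R 9 1.
Proof.
have dhE (K : numFieldType) := @split_cubic_roots K
  (evenq_dh 1 (-2) 0) 4 0 1 (-1) isT
  (ltac:(move=> z; evenq_ring)).
have dgE (K : numFieldType) := @split_cubic_roots K
  (evenq_dg 0 0 (-1) 1 (-2) 0) 4 0 1 (-1) isT
  (ltac:(move=> z; evenq_ring)).
(* A sum of two double wells, [x^4 - 2 x^2 + y^4 - 2 y^2], with its maximum at the origin. *)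
apply: (@evenq_realizes_int 0 0 (-1) 1 (-2) 0 R
  [:: 0; 1; -1] [:: 0; 1; -1]) => //.
- by move=> K z /dhE; apply: dh_simple_at_ints.
- by move=> K z /dgE; apply: dg_simple_at_ints.
- exact: dhE.
- exact: dgE.
Qed.

End Examples.

Theorem theorem2 (R : realType) (M m : nat) :
  (exists c : coeffs4 R,
     [/\ morse4 c, top_pos c, num_real_crit c M & num_local_max c m])
  <-> (M, m) \in realized_pairs.
Proof.
split=> [[c [morse pos crit max]]|].
  have [oddM M10] := odd_num_real_crit R c M morse pos crit.
  have [m1 M1] := morse4_local_max_count R c M m morse pos crit max.
  case: m m1 M1 {max} => [|[|//]] _ M1.
    by case: M oddM M10 {crit M1} => [|[|[|[|[|[|[|[|[|[|M]]]]]]]]]].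
  by case: M oddM M10 M1 {crit} => [|[|[|[|[|[|[|[|[|[|M]]]]]]]]]] // _ _ /(_ erefl).
rewrite !inE !xpair_eqE => H.
do 8 (case/orP: H => [/andP[/eqP -> /eqP ->]|H]; first by
  first [exact: realizable_1_0 | exact: realizable_3_0 | exact: realizable_5_0
    | exact: realizable_7_0 | exact: realizable_9_0 | exact: realizable_3_1
    | exact: realizable_5_1 | exact: realizable_7_1]).
by case/andP: H => /eqP -> /eqP ->; exact: realizable_9_1.
Qed.
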